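(* Let $\mathcal{A}$ be a finite linearly ordered alphabet with minimal element $\underline{a}$, and consider $\mathrm{IPS}(P)$ with alphabet $\mathcal{A}$ over a lattice $\Lambda$ such that $(\Lambda,\mathrm{Exp}(1))$ is causal. Assume that there exists a product basis with values $x,y:\mathcal{A}\setminus\{\underline{a}\}\to\mathbb{R}$ (with $x(a)\ne y(a)$ for all $a$) such that: 1. the values of $x$ and $y$ are bounded by $\pm1$, i.e. $|x(a)|\le1$ and $|y(a)|\le 1$ for all $a\in\mathcal{A}\setminus\{\underline a\}$; 2. $x(a)y(a)\le0$ for all $a\in\mathcal{A}\setminus\{\underline{a}\}$; 3. for all $a>b>\underline{a}$, $|x(b)|+|y(a)|+|x(b)y(a)|\le1$; 4. the constants $C^{(j,a)}_{\{j\},a}$, $j\in\Lambda$, $a\in\mathcal{A}\setminus\{\underline{a}\}$, are uniformly bounded; 5. $$\alpha:=\sup_{j\in\Lambda,\ a\in\mathcal{A}\setminus\{\underline{a}\}}\Bigg(C^{(j,a)}_{\{j\},a}+\sum_{\substack{S\subseteq\mathcal{N}_j,\ a_S\in(\mathcal{A}\setminus\{\underline{a}\})^S\\ (S,a_S)\ne(\{j\},a)}}\big|C^{(j,a)}_{S,a_S}\big|\Bigg)<1.$$ Then $\mathrm{IPS}(P)$ has uniform, exponential decay of correlations. More precisely, for all local functions $f,g\in\mathbf{F}$ and every trajectory $\zeta\in\mathrm{IPS}(P)$ (i.e. for every initial distribution), and all $t\ge0$, $$|\mathrm{Cov}(f(\zeta_0),g(\zeta_t))|\le 2\|f\|_\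infty\,\|g\|_{\Pi}\,e^{-(1-\alpha)t}.$$
   Context: A lattice is a countable set $\Lambda$ of sites in which each $j\in\Lambda$ has a neighbourhood $\mathcal{N}_j\subseteq\Lambda$ with $j\in\mathcal{N}_j$. A transition matrix $P$ is a collection of probability distributions $P_j(\cdot\,|\,\sigma)$ on $\mathcal{A}$, for $j\in\Lambda$, $\sigma\in\mathcal{A}^{\mathcal{N}_j}$; for $\zeta\in\mathcal{A}^\Lambda$ write $P_j(\cdot\,|\,\zeta):=P_j(\cdot\,|\,\zeta|_{\mathcal{N}_j})$. $\mathrm{IPS}(P)$: every site has an independent rate-$1$ exponential clock; whenever the clock at $j$ rings at time $\tau$, the state at $j$ is resampled from $P_j(\cdot\,|\,\zeta_{\tau^-})$ (left limit) independently of everything else, and states do not change otherwise; the initial distribution of $\zeta_0$ on $\mathcal{A}^\Lambda$ is arbitrary and independent of the clocks. $(\Lambda,\mathrm{Exp}(1))$ is causal if for every $(t,j)$ the backward exploration of the space-time points that can influence $(t,j)$ (start with $K_0=\{j\}$ at time $t$; going backward in time, whenever a clock rings at a site $i$ of the current set $K_n$, replace $K_n$ by $K_n\cup\mathcal{N}_i$) almost surely reaches time $0$ after finitely many steps. This makes the process well defined and forces the $\mathcal{N}_j$ to be finite (but not uniformly bounded in size). $\mathbf{F}$ is the linear space of local functions $f:\mathcal{A}^\Lambda\to\mathbb{R}$, i.e. functions depending on finitely many coordinates only. Product basis with values $x,y$: for $j\in\Lambda$, $a\in\mathcal{A}\setminus\{\underline{a}\}$ let $\chi_{\{j\},a}(\zeta)=x(a)$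 if $\zeta(j)\ge a$ and $y(a)$ if $\zeta(j)<a$. For finite $K\subseteq\Lambda$ and $a_K\in(\mathcal{A}\setminus\{\underline{a}\})^K$ let $\chi_{K,a_K}=\prod_{j\in K}\chi_{\{j\},a_K(j)}$, with $\chi_\varnothing=1$. The family $\mathcal{F}_\Pi(x,y)$ of all these functions is a linear basis of $\mathbf{F}$. The semi-norm $\|f\|_\Pi$ is the sum of the absolute values of the coefficients of $f$ in this basis, excluding the coefficient of the constant function $\chi_\varnothing=1$. Update coefficients: let $E_j(f)(\sigma)$ be the expected value of $f$ after a single update at site $j$ starting from $\sigma$, i.e. $E_j(f)(\sigma)=\sum_{b\in\mathcal{A}}P_j(b\,|\,\sigma)f(\sigma^{j\to b})$ with $\sigma^{j\to b}$ equal to $\sigma$ except for value $b$ at $j$. The coefficients $C^{(j,a)}_{S,a_S}$ are defined by $$E_j(\chi_{\{j\},a})=\sum_{S\subseteq\mathcal{N}_j,\ a_S\in(\mathcal{A}\setminus\{\underline{a}\})^S}C^{(j,a)}_{S,a_S}\,\chi_{S,a_S}.$$ The sum includes $S=\varnothing$. Exponential decay of correlations: there is a rate $r>0$ and for all $f,g\in\mathbf{F}$ a constant $C(f,g)$ with $|\mathrm{Cov}(f(\zeta_0),g(\zeta_t))|\le C(f,g)e^{-rt}$ for all initial distributions; uniform decay: $\sup|\mathrm{Cov}(f(\zeta_0),g(\zeta_t))|\to0$ as $t\to\infty$, the supremum being over all initial distributions. *)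

(* Defs.v *)
From HB Require Import structures.
From mathcomp Require Import all_boot all_order all_algebra finmap.
From mathcomp Require Import all_classical all_reals all_analysis.

Set Implicit Arguments.
Unset Strict Implicit.
Unset Printing Implicit Defensive.

Import Order.TTheory GRing.Theory Num.Theory numFieldNormedType.Exports.

Local Open Scope classical_set_scope.
Local Open Scope ring_scope.

Section Alphabet.
Context {R : realType} {dA : Order.disp_t} {A : finTBOrderType dA}
  {L : countType}.

Definition nonmin : Type := {a : A | a != \bot%O}.
HB.instance Definition _ := Finite.on nonmin.
HB.instance Definition _ := SubType.on nonmin.

Definition is_local (f : (L -> A) -> R) : Prop :=
  exists K : {fset L}, forall s s' : L -> A,
    (forall j, j \in K -> s j = s' j) -> f s = f s'.

Definition sup_norm (f : (L -> A) -> R) : R := sup (range (fun s => `|f s|)).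

(* A pair (K, a_K), with K a finite set of sites and a_K : K -> A \ {\bot}, is
   a finite map with domain K. *)
Definition pindex : Type := {fmap L -> nonmin}.
HB.instance Definition _ := Choice.on pindex.

Definition pindex1 (j : L) (a : nonmin) : pindex := [fmap].[j <- a]%fmap.

Definition chi1 (x y : nonmin -> R) (j : L) (a : nonmin) (s : L -> A) : R :=
  if (val a <= s j)%O then x a else y a.

Definition chi (x y : nonmin -> R) (m : pindex) (s : L -> A) : R :=
  \prod_(j : domf m) chi1 x y (val j) (m j) s.

(* When x a != y a for all a, the functions chi form a basis of the local
   functions (chi_coefP and chi_coef_unique below), so that there is exactly
   one such finitely supported family if f is local. *)
Definition chi_coef (x y : nonmin -> R) (f : (L -> A) -> R) :
    {fsfun pindex -> R with 0} :=
  xget [fsfun] [set c : {fsfun pindex -> R with 0} |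
    forall s, f s = \sum_(m <- finsupp c) c m * chi x y m s].

Definition pi_norm (x y : nonmin -> R) (f : (L -> A) -> R) : R :=
  \sum_(m <- finsupp (chi_coef x y f) | m != [fmap]%fmap)
    `|chi_coef x y f m|.

(* The neighbourhoods are finite sets from the outset: this is forced by
   causality. *)
Definition transition_family (N : L -> {fset L}) : Type :=
  forall j : L, {ffun N j -> A} -> A -> R.

Definition is_transition_matrix (N : L -> {fset L}) (p : transition_family N) :
    Prop :=
  forall j s, (forall b, 0 <= p j s b) /\ \sum_b p j s b = 1.

Definition restr (K : {fset L}) (s : L -> A) : {ffun K -> A} :=
  [ffun i : K => s (val i)].

Definition set_site (s : L -> A) (j : L) (b : A) : L -> A :=
  fun i => if i == j then b else s i.

Definition update_mean (N : L -> {fset L}) (p : transition_family N) (j : L)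
    (f : (L -> A) -> R) (s : L -> A) : R :=
  \sum_b p j (restr (N j) s) b * f (set_site s j b).

(* C^{(j,a)}_m for m = (S, a_S); by uniqueness of the coefficients it vanishes
   unless S is included in N j (see update_coefP). *)
Definition update_coef (x y : nonmin -> R) (N : L -> {fset L})
    (p : transition_family N) (j : L) (a : nonmin) :
    {fsfun pindex -> R with 0} :=
  chi_coef x y (update_mean p j (chi x y (pindex1 j a))).

(* In \bar R, so that the supremum is never a junk value. *)
Definition alpha (x y : nonmin -> R) (N : L -> {fset L})
    (p : transition_family N) : \bar R :=
  ereal_sup (range (fun ja : L * nonmin =>
    let C := update_coef x y p ja.1 ja.2 in
    let m0 := pindex1 ja.1 ja.2 in
    (C m0 + \sum_(m <- finsupp C | (domf m `<=` N ja.1)%fset && (m != m0))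
              `|C m|)%:E)).

End Alphabet.

Arguments nonmin {dA} A.
Arguments pindex {dA} A L.
Arguments transition_family R {dA} A {L} N.

Section Basis.
Context {R : realType} {dA : Order.disp_t} {A : finTBOrderType dA}
  {L : countType}.
Local Notation nonmin := (nonmin A).
Local Notation pindex := (pindex A L).

Let expands (x y : nonmin -> R) (K : {fset L}) (f : (L -> A) -> R) : Prop :=
  exists2 l : seq (R * pindex),
    all (fun rm : R * pindex => domf rm.2 `<=` K)%fset l &
    forall s, f s = \sum_(rm <- l) rm.1 * chi x y rm.2 s.

Let expandsD x y K f g : expands x y K f -> expands x y K g ->
  expands x y K (fun s => f s + g s).
Proof.
move=> [l hl lE] [k hk kE]; exists (l ++ k); first by rewrite all_cat hl hk.
by move=> s; rewrite big_cat /= lE kE.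
Qed.

Let expandsZ x y K r f : expands x y K f -> expands x y K (fun s => r * f s).
Proof.
move=> [l hl lE]; exists [seq (r * rm.1, rm.2) | rm <- l]; first by rewrite all_map.
by move=> s; rewrite big_map lE mulr_sumr; apply: eq_bigr => i _; rewrite mulrA.
Qed.

Let expands_sum x y K (I : Type) (e : seq I) (Q : pred I) (F : I -> (L -> A) -> R) :
  (forall i, Q i -> expands x y K (F i)) ->
  expands x y K (fun s => \sum_(i <- e | Q i) F i s).
Proof.
move=> h; elim: e => [|i e IH].
  by exists [::] => // s; rewrite !big_nil.
case Qi: (Q i); last first.
  by case: IH => l hl lE; exists l => // s; rewrite big_cons Qi.
have [l hl lE] := expandsD (h _ Qi) IH.
by exists l => // s; rewrite big_cons Qi lE.
Qed.

Let chiE (x y : nonmin -> R) (m : pindex) s :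
  chi x y m s = \prod_(j <- domf m) oapp (fun a => chi1 x y j a s) 1 m.[? j]%fmap.
Proof.
rewrite big_seq_fsetE /chi /=; apply: eq_bigr => j _.
rewrite in_fnd /= (_ : [` fsvalP j]%fset = j) //; exact: val_inj.
Qed.

Let chi_setf (x y : nonmin -> R) (m : pindex) j a s : j \notin domf m ->
  chi x y m.[j <- a]%fmap s = chi1 x y j a s * chi x y m s.
Proof.
move=> jm; rewrite !chiE.
pose G i := oapp (fun b => chi1 x y i b s) 1 m.[j <- a].[? i]%fmap.
rewrite -/(\prod_(i <- domf m.[j <- a]%fmap) G i).
have -> : \prod_(i <- domf m.[j <- a]%fmap) G i =
    \prod_(i <- (j |` domf m)%fset) G i by rewrite dom_setf.
rewrite big_fsetU1 //= {1}/G fnd_set eqxx /=; congr (_ * _).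
rewrite /G big_seq [RHS]big_seq; apply: eq_bigr => i im; rewrite fnd_set ifN //.
by apply: contraNneq jm => <-.
Qed.

Let expands_ge x y (K : {fset L}) j f b : (forall a, x a != y a) -> j \notin K ->
  expands x y K f ->
  expands x y (j |` K)%fset (fun s => (b <= s j)%O%:R * f s).
Proof.
move=> xy jK fK.
have fjK : expands x y (j |` K)%fset f.
  case: fK => l hl lE; exists l => //; apply: sub_all hl => rm /= h.
  exact/(fsubset_trans h)/fsubsetU1.
have [->|b0] := eqVneq b \bot%O.
  by case: fjK => l hl lE; exists l => // s; rewrite le0x mul1r.
pose a : nonmin := exist _ b b0.
have h1 : expands x y (j |` K)%fset (fun s => chi1 x y j a s * f s).
  case: fK => l hl lE.
  exists [seq (rm.1, rm.2.[j <- a]%fmap) | rm <- l].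
    rewrite all_map; apply: sub_all hl => rm /= h.
    exact: fsetUS.
  move=> s; rewrite big_map lE mulr_sumr big_seq [RHS]big_seq; apply: eq_bigr.
  move=> rm rml /=; have /fsubsetP h := allP hl rm rml; rewrite chi_setf; first by rewrite mulrCA.
  by apply: contra jK => /h.
have [l hl lE] := expandsD (expandsZ (x a - y a)^-1 h1)
                           (expandsZ (- ((x a - y a)^-1 * y a)) fjK).
exists l => // s; rewrite -lE /chi1 /=.
have xy0 : x a - y a != 0 by rewrite subr_eq0.
case: ifP => _ /=; last by rewrite !mulNr mulrA subrr mul0r.
by rewrite mulrA -mulrDl -mulrBr mulVf.
Qed.

Let expands_eq x y (K : {fset L}) j f b : (forall a, x a != y a) -> j \notin K ->
  expands x y K f ->
  expands x y (j |` K)%fset (fun s => (b == s j)%:R * f s).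
Proof.
move=> xy jK fK.
have [n] := ubnP #|[pred b' | (b < b')%O]|; elim: n b => // n IH b; rewrite ltnS => hb.
have hsum : expands x y (j |` K)%fset
    (fun s => \sum_(b' <- index_enum A | (b < b')%O) (b' == s j)%:R * f s).
  apply: expands_sum => b' bb'; apply: IH; apply: leq_trans hb.
  apply: proper_card; apply/properP; split.
    by apply/fintype.subsetP => c; rewrite !inE; exact: lt_trans.
  by exists b'; rewrite !inE ?bb' ?ltxx.
have [l hl lE] := expandsD (expands_ge b xy jK fK) (expandsZ (-1) hsum).
exists l => // s; rewrite -lE -mulr_suml mulN1r -mulNr -mulrDl; congr (_ * _).
case: (ltgtP b (s j)) => [bs|bs|->] /=.
- by rewrite (bigD1 (s j)) //= eqxx big1 ?addr0 ?subrr // => b' /andP[_ /negPf ->].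
- rewrite big1 ?subrr // => b' bb'; case: eqP => // b'E.
  by have := lt_trans bs bb'; rewrite b'E ltxx.
- rewrite big1 ?subr0 // => b' bb'; case: eqP => // b'E.
  by move: bb'; rewrite b'E ltxx.
Qed.

Let expands_local x y (K : {fset L}) (f : (L -> A) -> R) :
  (forall a, x a != y a) ->
  (forall s s' : L -> A, (forall j, j \in K -> s j = s' j) -> f s = f s') ->
  expands x y K f.
Proof.
move=> xy; elim/finSet_rect: K f => K IH f fK.
have [K0|[j jK]] := fset_0Vmem K.
  exists [:: (f (fun=> \bot%O), [fmap]%fmap)].
    by rewrite /= andbT fsub0set.
  move=> s; rewrite big_seq1 chiE big_seq_fset0 mulr1.
  by apply: fK => i; rewrite K0 inE.
have jK' : j \notin (K `\ j)%fset by rewrite !inE eqxx.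
have [] := @expands_sum x y K A (index_enum A) predT
    (fun b s => (b == s j)%:R * f (set_site s j b)).
  move=> b _; rewrite -(fsetD1K jK); apply: expands_eq => //.
  apply: IH; first by rewrite fproperD1.
  move=> s s' ss'; apply: fK => i iK; rewrite /set_site; case: ifP => // /negbT ij.
  by apply: ss'; rewrite !inE ij.
move=> l hl lE; exists l => // s; rewrite -lE (bigD1 (s j)) //= eqxx mul1r.
rewrite big1 ?addr0; last by move=> b /negPf ->; rewrite mul0r.
by apply: fK => i iK; rewrite /set_site; case: eqP => // ->.
Qed.

Let expansion_ex x y (K : {fset L}) (f : (L -> A) -> R) :
  (forall a, x a != y a) ->
  (forall s s' : L -> A, (forall j, j \in K -> s j = s' j) -> f s = f s') ->
  exists2 c : {fsfun pindex -> R with 0},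
    (forall m, m \in finsupp c -> (domf m `<=` K)%fset) &
    forall s, f s = \sum_(m <- finsupp c) c m * chi x y m s.
Proof.
move=> xy /(expands_local xy)[l hl lE].
pose D : {fset pindex} := [fset m | m in [seq rm.2 | rm <- l]]%fset.
pose c : {fsfun pindex -> R with 0} :=
  [fsfun m in D => \sum_(rm <- l | rm.2 == m) rm.1 | 0].
have cD : (finsupp c `<=` D)%fset by exact: finsupp_sub.
exists c.
  move=> m /(fsubsetP cD); rewrite inE /= => /mapP[rm rml ->].
  exact: (allP hl).
move=> s; rewrite (big_fset_incl _ cD) /=; last first.
  by move=> m _ /fsfun_dflt ->; rewrite mul0r.
rewrite lE big_seq [RHS]big_seq.
under [RHS]eq_bigr => m mD do rewrite fsfun_fun mD mulr_suml.
rewrite -big_seq [RHS](exchange_big_dep predT) //= [RHS]big_seq [LHS]big_seq.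
apply: eq_bigr => rm rml.
have mD : rm.2 \in D by rewrite inE /=; apply: map_f.
rewrite big_mkcond (bigD1_seq rm.2) ?fset_uniq //= eqxx mD big1 ?addr0 // => m.
by rewrite eq_sym => /negPf ->; rewrite andbF.
Qed.

Let pre (a : A) : A := [arg max_(b > \bot | (b < a)%O) b]%O.

Let preP (a c : A) : a != \bot%O -> (c <= pre a)%O = (c < a)%O.
Proof.
move=> a0; rewrite /pre; case: arg_maxP => [|b ba bmax]; first by rewrite lt0x.
apply/idP/idP => [cb|/bmax//]; exact: le_lt_trans ba.
Qed.

Let dual (a : nonmin) (b : A) : R := (b == val a)%:R - (b == pre (val a))%:R.

Let sum_dual a (F : A -> R) :
  \sum_b dual a b * F b = F (val a) - F (pre (val a)).
Proof.
under eq_bigr do rewrite mulrBl.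
rewrite big_split sumrN /=; congr (_ - _).
  rewrite (bigD1 (val a)) //= eqxx mul1r big1 ?addr0 // => b /negPf ->.
  by rewrite mul0r.
rewrite (bigD1 (pre (val a))) //= eqxx mul1r big1 ?addr0 // => b /negPf ->.
by rewrite mul0r.
Qed.

Let dual_chi1 (x y : nonmin -> R) a c :
  \sum_b dual a b * (if (val c <= b)%O then x c else y c) =
  if a == c then x a - y a else 0.
Proof.
rewrite sum_dual preP ?(valP a) //.
case: eqVneq => [->|ac]; first by rewrite lexx ltxx.
rewrite lt_neqAle (_ : val c != val a) ?subrr //.
by rewrite (inj_eq val_inj) eq_sym.
Qed.

Let ext (K : {fset L}) (t : {ffun K -> A}) (i : L) : A :=
  oapp t \bot%O (insub i).

Let dual_chi (x y : nonmin -> R) (m m' : pindex) :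
  exists2 r, (m = m' -> r = 1) &
  \sum_(t : {ffun domf m -> A})
     (\prod_j dual (m j) (t j)) * chi x y m' (ext t) =
  (\prod_(j : domf m) (if m'.[? val j]%fmap == Some (m j)
                       then x (m j) - y (m j) else 0)) * r.
Proof.
pose phi c b := if (val c <= b)%O then x c else y c.
pose g i b := oapp (phi^~ b) 1 m'.[? i]%fmap.
pose rest := \prod_(i <- (domf m' `\` domf m)%fset) g i \bot%O.
exists rest; first by rewrite /rest => ->; rewrite fsetDv big_seq_fset0.
have chiX (t : {ffun domf m -> A}) :
    chi x y m' (ext t) = (\prod_j g (val j) (t j)) * rest.
  rewrite chiE -/(\prod_(i <- domf m') g i (ext t i)).
  rewrite (big_fset_incl _ (fsubsetUr (domf m) (domf m'))) /=; last first.
    by move=> i _ im'; rewrite /g not_fnd.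
  rewrite (big_fsetID _ (mem (domf m))) /=; congr (_ * _).
    rewrite (_ : [fset _ in _ | _]%fset = domf m); last first.
      by apply/fsetP => i; rewrite !inE andbC; case: (i \in domf m); rewrite ?andbF.
    rewrite big_seq_fsetE; apply: eq_bigr => j _; rewrite /= /ext insubT //=.
    by move=> jm; congr (g _ (t _)); apply: val_inj.
  rewrite /rest (_ : [fset _ in _ | _]%fset = (domf m' `\` domf m)%fset); last first.
    by apply/fsetP => i; rewrite !inE andbC; case: (i \in domf m); rewrite ?andbF.
  rewrite big_seq [RHS]big_seq; apply: eq_bigr => i; rewrite inE => /andP[im _].
  by rewrite /ext insubF //; exact/negbTE.
under eq_bigr do rewrite chiX mulrA -big_split /=.
rewrite -mulr_suml; congr (_ * _).
rewrite -(bigA_distr_bigA (fun (j : domf m) b => dual (m j) b * g (val j) b)).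
apply: eq_bigr => j _; rewrite /g; case: fndP => [km'|km'] /=.
  by rewrite dual_chi1 eq_sym /= (inj_eq (@Some_inj _)).
by rewrite sum_dual subrr.
Qed.

Let chi_free (x y : nonmin -> R) (D : {fset pindex}) (h : pindex -> R) :
  (forall a, x a != y a) ->
  (forall s, \sum_(m <- D) h m * chi x y m s = 0) ->
  forall m, m \in D -> h m = 0.
Proof.
move=> xy h0.
pose B := \max_(m <- D) #|` domf m|.
suff H n m : m \in D -> (B < #|` domf m| + n)%N -> h m = 0.
  by move=> m mD; apply: (H B.+1) => //; rewrite addnS ltnS leq_addl.
elim: n m => [|n IH] m mD.
  by rewrite addn0 ltnNge (leq_bigmax_seq m).
rewrite addnS ltnS => mB.
have : \sum_(t : {ffun domf m -> A}) (\prod_j dual (m j) (t j)) *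
    \sum_(m' <- D) h m' * chi x y m' (ext t) = 0.
  by apply: big1 => t _; rewrite h0 mulr0.
under eq_bigr do rewrite mulr_sumr.
rewrite exchange_big /= (big_rem m) //= [X in _ + X]big_seq [X in _ + X]big1.
  move/eqP; rewrite addr0.
  under eq_bigr do rewrite mulrCA.
  rewrite -mulr_sumr; have [r -> // ->] := dual_chi x y m m.
  rewrite mulr1 mulf_eq0 => /orP[/eqP//|].
  rewrite prodf_seq_eq0 => /hasP[j _ /=].
  rewrite Some_fnd eqxx subr_eq0; exact/contraTeq.
move=> m'; rewrite mem_rem_uniq ?fset_uniq // inE => /andP[mm' m'D].
under eq_bigr do rewrite mulrCA.
rewrite -mulr_sumr.
have [le|gt] := leqP #|` domf m'| #|` domf m|; last first.
  rewrite IH ?mul0r //; apply: leq_ltn_trans mB _; by rewrite ltn_add2r.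
have [r _ ->] := dual_chi x y m m'.
have [/forallP E|] := boolP [forall j : domf m, m'.[? val j]%fmap == Some (m j)].
  have sub : (domf m `<=` domf m')%fset.
    apply/fsubsetP => i im; by have := E [` im]%fset => /=; case: fndP.
  have dE : domf m = domf m' by apply/eqP; rewrite eqEfcard sub.
  case/eqP: mm'; apply/fmapP => i; case: (fndP m) => [im|im].
    by have /eqP := E [` im]%fset.
  have im' : i \notin domf m' by rewrite -dE.
  by rewrite not_fnd.
rewrite negb_forall => /existsP[j /negPf jE].
by rewrite (bigD1 j) //= jE !mul0r mulr0.
Qed.

Lemma chi_coef_unique (x y : nonmin -> R) (c c' : {fsfun pindex -> R with 0}) :
  (forall a, x a != y a) ->
  (forall s, \sum_(m <- finsupp c) c m * chi x y m s =
             \sum_(m <- finsupp c') c' m * chi x y m s) -> c = c'.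
Proof.
move=> xy cc'; pose D := (finsupp c `|` finsupp c')%fset.
have E : forall m, m \in D -> c m - c' m = 0.
  apply: (@chi_free x y D (fun m => c m - c' m) xy) => s.
  under eq_bigr do rewrite mulrBl.
  rewrite sumrB; move: (cc' s).
  rewrite (big_fset_incl _ (fsubsetUl (finsupp c) (finsupp c'))) /=; last first.
    by move=> m _ /fsfun_dflt ->; rewrite mul0r.
  rewrite (big_fset_incl _ (fsubsetUr (finsupp c) (finsupp c'))) /=; last first.
    by move=> m _ /fsfun_dflt ->; rewrite mul0r.
  by move=> ->; rewrite subrr.
apply/fsfunP => m; have [/E/eqP|] := boolP (m \in D).
  by rewrite subr_eq0 => /eqP.
by rewrite in_fsetU negb_or => /andP[/fsfun_dflt -> /fsfun_dflt ->].
Qed.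

Let chi_coef_supp (x y : nonmin -> R) (K : {fset L}) f :
  (forall a, x a != y a) ->
  (forall s s' : L -> A, (forall j, j \in K -> s j = s' j) -> f s = f s') ->
  (forall m, m \in finsupp (chi_coef x y f) -> (domf m `<=` K)%fset) /\
  forall s, f s = \sum_(m <- finsupp (chi_coef x y f)) chi_coef x y f m * chi x y m s.
Proof.
move=> xy fK; have [c cK cE] := expansion_ex xy fK.
suff -> : chi_coef x y f = c by []; apply: xget_unique => //.
by move=> c' c'E; apply: (chi_coef_unique xy) => s; rewrite -cE -c'E.
Qed.

Lemma chi_coefP (x y : nonmin -> R) (f : (L -> A) -> R) :
  (forall a, x a != y a) -> is_local f ->
  forall s, f s =
    \sum_(m <- finsupp (chi_coef x y f)) chi_coef x y f m * chi x y m s.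
Proof. by move=> xy [K /(chi_coef_supp xy)[]]. Qed.

Lemma update_coefP (x y : nonmin -> R) (N : L -> {fset L})
    (p : transition_family R A N) (j : L) (a : nonmin) :
  (forall a, x a != y a) -> j \in N j ->
  (forall m, m \in finsupp (update_coef x y p j a) -> (domf m `<=` N j)%fset) /\
  forall s, update_mean p j (chi x y (pindex1 j a)) s =
    \sum_(m <- finsupp (update_coef x y p j a))
      update_coef x y p j a m * chi x y m s.
Proof.
move=> xy jN; apply: chi_coef_supp => // s s' ss'; rewrite /update_mean.
have -> : restr (N j) s = restr (N j) s'.
  by apply/ffunP => i; rewrite !ffunE; apply: ss'; exact: valP.
apply: eq_bigr => b _; congr (_ * _); apply: eq_bigr => i _.
rewrite /chi1 /set_site (_ : val i == j) //.
have := fsvalP i; rewrite -[val i]/(fsval i); move: (fsval i) => k.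
by rewrite /pindex1 dom_setf !inE orbF.
Qed.

End Basis.

Definition mutually_independent {R : realType} {d : measure_display}
    {T : measurableType d} (P : probability T R) (I : choiceType)
    (F : I -> set (set T)) : Prop :=
  forall (J : {fset I}) (E : I -> set T),
    (forall i, i \in J -> F i (E i)) ->
    P (\bigcap_(i in [set` J]) E i) = (\prod_(i <- J) P (E i))%E.

Definition generated {d d' : measure_display} {T : measurableType d}
    {T' : measurableType d'} (X : T -> T') : set (set T) :=
  [set X @^-1` B | B in measurable].

Section Clocks.
Context {R : realType} {L : countType} {d : measure_display}
  {T : measurableType d}.

(* W j 0 is the time of the first ring of the clock at j, and W j n.+1 is the
   waiting time between the ring with index n (counted from 0) and the next. *)
Definition exponential_clocks (P : probability T R)
    (W : L -> nat -> {RV P >-> R}) : Prop :=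
  (forall j n B, measurable B -> distribution P (W j n) B = exponential_prob 1 B)
  /\ mutually_independent P (fun jn : L * nat => generated (W jn.1 jn.2)).

Definition ring_time (W : L -> nat -> T -> R) (j : L) (n : nat) (w : T) : R :=
  \sum_(k < n.+1) W j k w.

Definition rings_at (W : L -> nat -> T -> R) (w : T) (j : L) (s : R) : Prop :=
  exists n, ring_time W j n w = s.

End Clocks.

(* The backward exploration started from the set K just before time t reaches
   time 0 after finitely many steps. *)
Inductive explored {R : realType} {L : countType} (N : L -> {fset L})
    (ring : L -> R -> Prop) : {fset L} -> R -> Prop :=
| explored_end (K : {fset L}) (t : R) :
    (forall i s, i \in K -> ring i s -> ~ (0 < s < t)) ->
    explored N ring K t
| explored_ring (K : {fset L}) (t : R) (i : L) (s : R) :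
    i \in K -> ring i s -> 0 < s < t ->
    (forall i' s', i' \in K -> ring i' s' -> s' < t -> s' <= s) ->
    explored N ring (K `|` N i)%fset s ->
    explored N ring K t.

Definition causal (R : realType) (L : countType) (N : L -> {fset L}) : Prop :=
  forall (d : measure_display) (T : measurableType d) (P : probability T R)
    (W : L -> nat -> {RV P >-> R}),
  exponential_clocks W ->
  forall (t : R) (j : L), 0 <= t ->
    {ae P, forall w, explored N (rings_at (fun j n => W j n) w) [fset j]%fset t}.

Section IPS.
Context {R : realType} {dA : Order.disp_t} {A : finTBOrderType dA}
  {L : countType} {N : L -> {fset L}}.
Context {d : measure_display} {T : measurableType d}.

(* Sources of randomness: the initial state, the waiting times, and the
   responses: U j n w s is the state that j takes at its ring with index n if it then sees s in its neighbourhood. *)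
Definition sources (zeta0 : T -> L -> A) (W : L -> nat -> T -> R)
    (U : forall j : L, nat -> T -> {ffun {ffun N j -> A} -> A})
    (i : option (L * nat + L * nat)) : set (set T) :=
  match i with
  | None => <<s [set E | exists j a, E = [set w | zeta0 w j = a]] >>
  | Some (inl (j, n)) => generated (W j n)
  | Some (inr (j, n)) => [set U j n @^-1` B | B in [set: set _]]
  end.

(* For the discrete topology on A: the left limit at time t of s restricted to
   K exists and equals l. *)
Definition left_limit (s : R -> L -> A) (t : R) (K : {fset L})
    (l : {ffun K -> A}) : Prop :=
  forall i : K, \forall u \near t^'-, s u (val i) = l i.

Definition evolves (W : L -> nat -> T -> R)
    (U : forall j : L, nat -> T -> {ffun {ffun N j -> A} -> A})
    (zeta : R -> T -> L -> A) (w : T) : Prop :=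
  (forall j n, exists2 l : {ffun N j -> A},
      left_limit (fun u => zeta u w) (ring_time W j n w) l &
      zeta (ring_time W j n w) w j = U j n w l) /\
  (forall j u t, 0 <= u <= t ->
      (forall s, rings_at W w j s -> ~ (u < s <= t)) ->
      zeta t w j = zeta u w j).

(* zeta t w j is the state of site j at time t >= 0 (the values at negative
   times are irrelevant). *)
Definition in_IPS (p : transition_family R A N) (P : probability T R)
    (zeta : R -> T -> L -> A) : Prop :=
  (forall t j a, 0 <= t -> measurable [set w | zeta t w j = a]) /\
  exists (W : L -> nat -> {RV P >-> R})
      (U : forall j : L, nat -> T -> {ffun {ffun N j -> A} -> A}),
    [/\ exponential_clocks W,
        forall j n s b, measurable [set w | U j n w s = b] /\
          P [set w | U j n w s = b] = (p j s b)%:E,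
        mutually_independent P (sources (zeta 0) (fun j n => W j n) U) &
        {ae P, forall w, evolves (fun j n => W j n) U zeta w}].

Definition correlation (P : probability T R) (zeta : R -> T -> L -> A)
    (f g : (L -> A) -> R) (t : R) : \bar R :=
  covariance P (fun w => f (zeta 0 w)) (fun w => g (zeta t w)).

End IPS.

(* Quantifying over all members of IPS(P) quantifies over all initial
   distributions. *)
Definition exponential_decay (R : realType) (dA : Order.disp_t)
    (A : finTBOrderType dA) (L : countType) (N : L -> {fset L})
    (p : transition_family R A N) : Prop :=
  exists2 r : R, 0 < r &
  forall f g : (L -> A) -> R, is_local f -> is_local g ->
  exists C : R,
  forall (d : measure_display) (T : measurableType d) (P : probability T R)
    (zeta : R -> T -> L -> A), in_IPS p P zeta ->
  forall t : R, 0 <= t ->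
    (`|correlation P zeta f g t| <= (C * expR (- r * t))%:E)%E.

(* Convergence to 0 of the supremum over all initial distributions, written with
   an epsilon and a time that do not depend on the trajectory. *)
Definition uniform_decay (R : realType) (dA : Order.disp_t)
    (A : finTBOrderType dA) (L : countType) (N : L -> {fset L})
    (p : transition_family R A N) : Prop :=
  forall f g : (L -> A) -> R, is_local f -> is_local g ->
  forall e : R, 0 < e -> \forall t \near +oo,
  forall (d : measure_display) (T : measurableType d) (P : probability T R)
    (zeta : R -> T -> L -> A), in_IPS p P zeta ->
    (`|correlation P zeta f g t| <= e%:E)%E.

(* Main.v *)
Require Import Defs.
From HB Require Import structures.
From mathcomp Require Import all_boot all_order all_algebra finmap.
From mathcomp Require Import all_classical all_reals all_analysis measurable_realfun.
From mathcomp Require Import ring lra.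

Set Implicit Arguments.
Unset Strict Implicit.
Unset Printing Implicit Defensive.

Import Order.TTheory GRing.Theory Num.Theory numFieldNormedType.Exports.

Local Open Scope classical_set_scope.
Local Open Scope ring_scope.

(** Centre f so that f(zeta_0) has mean 0, and for an index m of the product
    basis put u_m(t) = E[f(zeta_0) chi_m(zeta_t)].  Then u_m vanishes for the
    constant chi_m = 1, and Cov(f(zeta_0), g(zeta_t)) is the sum over the other
    m of the coefficient of g at m times u_m(t).  So it suffices to show
    |u_m(t)| <= 2 |f| e^(-lam t) for lam = 1 - alpha and |f| the sup norm.

    Evolution.  An update happens at rate 1 at each site, so u_m' is the sum
    over the sites j of m of E[f(zeta_0) (E_j chi_m - chi_m)(zeta_t)]
    (one_step, in integrated form).  Behind this lies the independence of the
    state at time t from the clocks and responses that are still to come.  The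
    process is given only implicitly, through its jumps, and that independence
    comes from causality: the backward exploration expresses the state at time t
    through finitely many sources, all of which are used up by time t
    (trace_sound, adapted_state); the running waiting time is memoryless and the
    next response has not been looked at (hits_prob); and two rings in a finite
    set of sites during a time h have probability O(h^2) (crowded_le).

    Algebra.  E_j chi_m is the product of the other factors of chi_m with the
    expansion of E_j chi_(j,a), whose coefficients are the C^(j,a).  The
    conditions on x and y say that the product of two basis functions at one site
    expands with coefficient sum at most 1; hence so does the product of any two
    basis functions (unit_expansion_chiM).  Therefore E_j chi_m is C^(j,a)_(j,a)
    chi_m plus terms of total weight at most the off-diagonal sum of |C^(j,a)|
    (pairing_update).

    Comparison.  With k sites in m, the u_m thus solve a linear system with
    decay rate a_m and total off-diagonal weight b_m, where k lam + b_m <= a_m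
    <= k c; the bound c on the diagonal coefficients makes the second inequality
    possible.  The rates a_m are unbounded in m, so a maximum principle is not
    immediate.  But if |u_m(t)| <= S e^(-lam t) for all m, then the surplus
    (k - 1) lam for k >= 2, and the bounded rate a_m <= c for k = 1, improve S
    towards the initial bound by a factor that does not depend on m
    (decay_improve); iterating gives the claim (uniform_exponential_bound). *)

(** * Measurable comparisons *)

Section MeasurableComparison.
Context {R : realType} {d : measure_display} {T : measurableType d}.

Lemma measurable_set_lt (f g : T -> R) : measurable_fun setT f ->
  measurable_fun setT g -> measurable [set w | f w < g w].
Proof.
move=> mf mg; rewrite -[X in measurable X]setTI -[X in _ `&` X]preimage_true.
exact: (measurable_fun_ltr mf mg).
Qed.

Lemma measurable_set_le (f g : T -> R) : measurable_fun setT f ->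
  measurable_fun setT g -> measurable [set w | f w <= g w].
Proof.
move=> mf mg; rewrite -[X in measurable X]setTI -[X in _ `&` X]preimage_true.
exact: (measurable_fun_ler mf mg).
Qed.

End MeasurableComparison.

(** * Independent families and the exponential clock *)

Section Independence.
Context {R : realType} {d : measure_display} {T : measurableType d}
  (P : probability T R) {I : choiceType} (F : I -> set (set T)).

Definition joint_sigma (J : set I) : set (set T) := <<s \bigcup_(i in J) F i >>.

Lemma joint_sigma_sub (J J' : set I) : J `<=` J' ->
  joint_sigma J `<=` joint_sigma J'.
Proof.
move=> JJ'; apply: sub_sigma_algebra2 => A [i Ji FA].
by exists i => //; exact: JJ'.
Qed.

Lemma joint_sigma_in (J : set I) i A : J i -> F i A -> joint_sigma J A.
Proof. by move=> Ji FA; apply: sub_sigma_algebra; exists i. Qed.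

Hypothesis FI : forall i, setI_closed (F i).
Hypothesis FT : forall i, F i setT.
Hypothesis Fm : forall i, F i `<=` measurable.
Hypothesis indF : mutually_independent P F.

Let rect (J : set I) : set (set T) :=
  [set E | exists (K : {fset I}) (e : I -> set T),
    [/\ forall i, i \in K -> J i, forall i, F i (e i) &
        E = \bigcap_(i in [set` K]) e i] ].

Let rectI J : setI_closed (rect J).
Proof.
move=> _ _ [K [e [KJ Fe ->]]] [K' [e' [KJ' Fe' ->]]].
exists (K `|` K')%fset, (fun i => (if i \in K then e i else setT) `&`
                                  (if i \in K' then e' i else setT)).
split.
- by move=> i; rewrite in_fsetU => /orP[/KJ|/KJ'].
- by move=> i; apply: FI; case: ifP => // _.
- apply/seteqP; split => w /=.
    move=> [eK eK'] i /= _; split; case: ifP => // ?; [exact: eK|exact: eK'].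
  move=> ee; split => i /= iK.
    by have := ee i; rewrite /= in_fsetU iK /= => /(_ isT)[].
  by have := ee i; rewrite /= in_fsetU iK orbT /= => /(_ isT)[].
Qed.

Let rectT J : rect J setT.
Proof.
exists fset0, (fun=> setT); split => //.
by apply/seteqP; split.
Qed.

Let rect_gen J : joint_sigma J `<=` <<s rect J >>.
Proof.
apply: sub_sigma_algebra2 => A [i Ji FA].
exists [fset i]%fset, (fun i' => if i' == i then A else setT); split.
- by move=> i'; rewrite in_fset1 => /eqP ->.
- by move=> i'; case: eqP => // ->.
- apply/seteqP; split => w /=.
    by move=> Aw i' /=; case: eqP.
  by move=> /(_ i); rewrite /= in_fset1 eqxx; exact.
Qed.

Let rect_meas J : rect J `<=` measurable.
Proof.
move=> _ [K [e [KJ Fe ->]]]; apply: fin_bigcap_measurable => // i _.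
exact/Fm/Fe.
Qed.

Lemma joint_sigma_meas J : joint_sigma J `<=` measurable.
Proof.
apply: smallest_sub; first exact: sigma_algebra_measurable.
by move=> A [i _ /Fm].
Qed.

Let rect_indep J1 J2 A1 A2 : J1 `&` J2 = set0 -> rect J1 A1 -> rect J2 A2 ->
  P (A1 `&` A2) = (P A1 * P A2)%E.
Proof.
move=> J12 [K [e [KJ Fe ->]]] [K' [e' [KJ' Fe' ->]]].
have KK' i : i \in K -> i \notin K'.
  move=> iK; apply/negP => iK'.
  have : (J1 `&` J2) i by split; [exact: KJ|exact: KJ'].
  by rewrite J12.
pose e2 i := if i \in K then e i else e' i.
have -> : \bigcap_(i in [set` K]) e i `&` \bigcap_(i in [set` K']) e' i =
    \bigcap_(i in [set` (K `|` K')%fset]) e2 i.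
  apply/seteqP; split => w /=.
    move=> [eK eK'] i /=; rewrite /e2 in_fsetU.
    by case: (boolP (i \in K)) => [iK _|_ iK']; [exact: eK|exact: eK'].
  move=> ee; split => i /= iK.
    by have := ee i; rewrite /= /e2 in_fsetU iK /=; exact.
  have := ee i; rewrite /= /e2 in_fsetU iK orbT.
  by case: ifP => [/KK'|_]; [rewrite iK|exact].
rewrite !indF //; last by move=> i _; rewrite /e2; case: ifP.
rewrite (big_fsetID _ (mem K)) /=; congr (_ * _)%E.
- rewrite (_ : [fset _ in _ | _]%fset = K); last first.
    by apply/fsetP => i; rewrite !inE andbC; case: (i \in K).
  by rewrite big_seq [RHS]big_seq; apply: eq_bigr => i iK; rewrite /e2 iK.
- rewrite (_ : [fset _ in _ | _]%fset = K'); last first.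
    apply/fsetP => i; rewrite !inE andbC; case: (boolP (i \in K)) => //= iK.
    by rewrite (negbTE (KK' _ iK)).
  rewrite big_seq [RHS]big_seq; apply: eq_bigr => i iK'; rewrite /e2 ifN //.
  by apply: contraL iK'; exact: KK'.
Qed.

Let extend J B : measurable B ->
  (forall A, rect J A -> P (B `&` A) = (P B * P A)%E) ->
  forall A, joint_sigma J A -> P (B `&` A) = (P B * P A)%E.
Proof.
move=> mB BA A /rect_gen sA.
have PB0 : 0 <= fine (P B) by rewrite fine_ge0.
pose m1 := mrestr P mB; pose m2 := mscale (NngNum PB0) P.
have PBE : (P B) = (fine (P B))%:E by rewrite fineK // fin_num_measure.
have E : m1 A = m2 A.
  apply: (@g_sigma_algebra_measure_unique _ R T (rect J) (@rect_meas J)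
    (fun=> setT) (fun=> rectT J) _ m1 m2 (@rectI J)) => //.
  - by rewrite bigcup_const.
  - move=> E rE; change (P (E `&` B) = (fine (P B))%:E * P E)%E.
    by rewrite setIC BA // -PBE.
  - move=> _; change (P (setT `&` B) < +oo)%E.
    by rewrite setTI (le_lt_trans (probability_le1 _ _)) // ltry.
change (P (A `&` B) = (fine (P B))%:E * P A)%E in E.
by rewrite setIC -PBE in E.
Qed.

(** Two disjoint groups of an independent family are independent: the events
    that are finite intersections form a pi-system on each side, and the
    monotone class argument is applied to one side after the other. *)
Lemma joint_sigma_indep J1 J2 A1 A2 : J1 `&` J2 = set0 ->
  joint_sigma J1 A1 -> joint_sigma J2 A2 -> P (A1 `&` A2) = (P A1 * P A2)%E.
Proof.
move=> J12 sA1 sA2; apply: (@extend J2) => //; first exact: joint_sigma_meas sA1.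
move=> E rE; rewrite setIC muleC; apply: (@extend J1) => //.
  exact: rect_meas rE.
by move=> E' rE'; rewrite setIC muleC; apply: (rect_indep J12).
Qed.

End Independence.

Section Memoryless.
Context {R : realType} {d : measure_display} {T : measurableType d}
  (P : probability T R).

Lemma exponential_tail (mu : probability R R) (a : R) :
  (forall B, measurable B -> mu B = exponential_prob 1 B) -> 0 <= a ->
  mu `]a, +oo[%classic = (expR (- a))%:E.
Proof.
move=> muE a0.
have mu0 : mu [set 0] = 0%E by rewrite muE // /exponential_prob integral_set1.
have muN : mu `]-oo, 0[%classic = 0%E.
  rewrite muE // /exponential_prob integral0_eq // => x /=.
  by rewrite in_itv /= => x0; rewrite lt0_exponential_pdf.
have muI : mu `[0, a]%classic = (1 - expR (- a))%:E.
  move: a0; rewrite le_eqVlt => /orP[/eqP <-|a0].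
    by rewrite set_itv1 mu0 oppr0 expR0 subrr.
  by rewrite muE // exponential_prob_itv0c // EFinB mulN1r.
rewrite (_ : `]a, +oo[%classic = ~` (`]-oo, 0[%classic `|` `[0, a]%classic)); last first.
  apply/seteqP; split => x /=; rewrite !in_itv /= ?andbT.
    by move=> ax [|/andP[_]]; rewrite ?ltNge ?(le_trans a0 (ltW ax)) // leNgt ax.
  by move=> /not_orP[/negP]; rewrite -leNgt => -> /negP; rewrite /= -ltNge.
have mm : measurable (`]-oo, 0[%classic `|` `[0, a]%classic : set R) by exact: measurableU.
rewrite probability_setC // measureU //; last first.
  apply/seteqP; split => x //= []; rewrite !in_itv /= => x0 /andP[].
  by rewrite leNgt x0.
by rewrite [X in (_ - (X + _))%E]muN [X in (_ - (_ + X))%E]muI add0e -EFinB opprB addrCA subrr addr0 /=.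
Qed.

Lemma memoryless_joint (X W : {RV P >-> R}) (t h : R) :
  (forall B C, measurable B -> measurable C ->
     P (X @^-1` B `&` W @^-1` C) = (P (X @^-1` B) * P (W @^-1` C))%E) ->
  (forall C, measurable C -> distribution P W C = exponential_prob 1 C) ->
  0 <= h ->
  P [set w | X w <= t /\ t + h < X w + W w] =
  ((expR (- h))%:E * P [set w | (X w <= t)%R /\ (t < X w + W w)%R])%E.
Proof.
move=> indXW lawW h0.
pose Z : T -> R * R := fun w => (X w, W w).
have mZ : measurable_fun setT Z by exact/measurable_fun_pair.
pose ZZ : {RV P >-> (R * R)%type} :=
  HB.pack Z (isMeasurableFun.Build _ _ _ _ Z mZ).
pose A s : set (R * R) := [set xw | xw.1 <= t /\ t + s < xw.1 + xw.2].
have mA s : measurable (A s).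
  rewrite (_ : A s = [set xw | xw.1 <= t] `&` [set xw | t + s < xw.1 + xw.2]) //.
  apply: measurableI.
    exact: measurable_set_le.
  by apply: measurable_set_lt => //; exact: measurable_funD.
have PA s : 0 <= s -> P [set w | X w <= t /\ t + s < X w + W w] =
    ((expR (- s))%:E *
     \int[distribution P X]_x ((x <= t)%R%:R * expR (- (t - x)))%:E)%E.
  move=> s0.
  transitivity (distribution P ZZ (A s)) => //.
  have <- := @product_measure_unique _ _ _ _ _ (distribution P X)
    (distribution P W) (distribution P ZZ) indXW (A s) (mA s).
  rewrite /product_measure1 -ge0_integralZl //=; last first.
    apply/measurable_EFinP; apply: measurable_funM.
      have mle : measurable_fun setT (fun x : R => x <= t).
        exact: measurable_fun_ler.
      exact: (measurableT_comp (f := fun b : bool => b%:R : R)).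
    apply: measurableT_comp => //; apply: measurableT_comp => //.
    exact: measurable_funB.
  apply: eq_integral => x _ /=; case: leP => xt.
    rewrite (_ : xsection _ _ = `]t + s - x, +oo[%classic); last first.
      apply/seteqP; split => y; rewrite /xsection /A /= in_itv /= andbT inE /=.
        by move=> [_]; rewrite ltrBlDl.
      by rewrite ltrBlDl.
    rewrite -/(distribution P W _) exponential_tail //; last first.
      by rewrite -addrA [s - x]addrC addrA addr_ge0 // subr_ge0.
    by rewrite mul1r -EFinM -expRD; congr (expR _)%:E; ring.
  rewrite mul0r mule0 (_ : xsection _ _ = set0) ?measure0 //.
  apply/seteqP; split => y //; rewrite /xsection /A /= inE /= => -[].
  by rewrite leNgt xt.
rewrite PA // -[X in (_ * P X)%E](_ : [set w | X w <= t /\ t + 0 < X w + W w] = _);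
  last by rewrite addr0.
by rewrite (PA 0) // oppr0 expR0 mul1e.
Qed.

(** Lack of memory at a random time: [X] stands for the last ring before [t],
    [W] for the waiting time that is then running, and [B] for an event of the
    past.  Off [B] the time [X] is moved beyond [t], which turns the statement
    into one on the joint law of two independent variables. *)
Lemma memoryless (G : set (set T)) (X : T -> R) (W : {RV P >-> R}) (t h : R)
    (B : set T) :
  <<s G >> `<=` measurable ->
  (forall E C, <<s G >> E -> measurable C ->
     P (E `&` W @^-1` C) = (P E * P (W @^-1` C))%E) ->
  (forall C, measurable C -> distribution P W C = exponential_prob 1 C) ->
  measurable_fun (setT : set (g_sigma_algebraType G)) X ->
  <<s G >> B -> (forall w, B w -> X w <= t) -> 0 <= h ->
  P (B `&` [set w | t + h < X w + W w]) =
  ((expR (- h))%:E * P (B `&` [set w | (t < X w + W w)%R]))%E.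
Proof.
move=> Gm ind lawW mX GB BX h0.
pose X' w : R := if w \in B then X w else t + 1.
have mX' : measurable_fun (setT : set (g_sigma_algebraType G)) X'.
  apply: measurable_fun_if => //.
    by apply: (@measurable_fun_bool _ _ _ _ true); rewrite setTI preimage_mem_true.
  exact: measurable_funTS.
have mX'T : measurable_fun (setT : set T) X'.
  by move=> _ C mC; apply: Gm; exact: mX'.
pose XX : {RV P >-> R} := HB.pack X' (isMeasurableFun.Build _ _ _ _ X' mX'T).
have E s : 0 <= s -> B `&` [set w | t + s < X w + W w] =
    [set w | XX w <= t /\ t + s < XX w + W w].
  move=> s0; apply/seteqP; split => w /=.
    by move=> [Bw]; rewrite /X' mem_set // => ?; split => //; exact: BX.
  move=> []; rewrite /X'; case: ifPn => [/set_mem Bw //|_].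
  by rewrite leNgt ltrDl ltr01.
rewrite (E h) // memoryless_joint //.
  congr (_ * P _)%E.
  by have := E 0; rewrite addr0 => ->.
by move=> C D mC mD; apply: ind => //; rewrite -[X in <<s _ >> X]setTI; exact: mX'.
Qed.

Lemma memoryless_ring (G : set (set T)) (X : T -> R) (W : {RV P >-> R}) (t h : R)
    (B : set T) :
  <<s G >> `<=` measurable ->
  (forall E C, <<s G >> E -> measurable C ->
     P (E `&` W @^-1` C) = (P E * P (W @^-1` C))%E) ->
  (forall C, measurable C -> distribution P W C = exponential_prob 1 C) ->
  measurable_fun (setT : set (g_sigma_algebraType G)) X ->
  <<s G >> B -> (forall w, B w -> X w <= t) -> 0 <= h ->
  P (B `&` [set w | t < X w + W w <= t + h]) =
  ((1 - expR (- h))%:E * P (B `&` [set w | (t < X w + W w)%R]))%E.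
Proof.
move=> Gm ind lawW mX GB BX h0.
have mB : measurable B by exact: Gm.
have mXT : measurable_fun (setT : set T) X by move=> _ C mC; apply: Gm; exact: mX.
have mlt s : measurable [set w | s < X w + W w].
  by apply: measurable_set_lt => //; exact: measurable_funD.
have -> : B `&` [set w | t < X w + W w <= t + h] =
    (B `&` [set w | t < X w + W w]) `\` (B `&` [set w | t + h < X w + W w]).
  apply/seteqP; split => w /=.
    by move=> [Bw /andP[-> le]]; do 2?split => //; rewrite ltNge le => -[].
  move=> [[Bw lt]] nlt; split => //; rewrite lt /= leNgt; apply/negP => lt'.
  by apply: nlt; split.
have fin E : measurable E -> P E \is a fin_num by move=> ?; exact: fin_num_measure.
rewrite measureD; [|exact: measurableI|exact: measurableI|]; last first.
  by rewrite ltey_eq fin //; exact: measurableI.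
rewrite [X in (_ - P X)%E]setIidr; last first.
  move=> w /= [Bw lt]; split => //; apply: le_lt_trans lt; by rewrite lerDl.
rewrite (memoryless Gm ind lawW mX GB BX h0).
have mm : measurable (B `&` [set w | t < X w + W w]) by exact: measurableI.
rewrite -(fineK (fin _ mm)) -!EFinM -EFinN.
by rewrite -[X in (X + _)%E](fineK (fin _ mm)) -EFinD mulrBl mul1r.
Qed.
End Memoryless.

(** * The backward exploration along one trajectory *)

Section Trajectory.
Context {R : realType} {dA : Order.disp_t} {A : finTBOrderType dA}
  {L : countType} {N : L -> {fset L}}.
Implicit Types (r : L -> nat -> R) (Q : set (L * nat)) (K : {fset L})
  (s : R -> L -> A) (V : forall j : L, nat -> {ffun {ffun N j -> A} -> A}).

(** The backward exploration with its rings recorded in [l], latest first.  Rings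
    whose label is not in [Q] are invisible to it; this is what later makes the
    event that [l] is the record depend on the clocks in [Q] alone. *)
Fixpoint trace r Q K (t : R) (l : seq (L * nat)) : Prop :=
  match l with
  | [::] => forall i n, i \in K -> Q (i, n) -> ~ (0 < r i n < t)
  | (i, n) :: l' =>
      [/\ i \in K /\ Q (i, n), 0 < r i n < t,
          forall i' n', i' \in K -> Q (i', n') -> r i' n' < t ->
            r i' n' <= r i n &
          trace r Q (K `|` N i)%fset (r i n) l']
  end.

(** The forward pass: the updates recorded in [l], applied to [s0], oldest
    first. *)
Fixpoint replay V (s0 : L -> A) (l : seq (L * nat)) : L -> A :=
  match l with
  | [::] => s0
  | (i, n) :: l' =>
      set_site (replay V s0 l') i (V i n (restr (N i) (replay V s0 l')))
  end.

(** Labels that ring at or after the starting time cannot be met, so an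
    exploration that terminates also does so when they are hidden. *)
Lemma trace_complete r Q K t : explored N (fun j u => exists n, r j n = u) K t ->
  (forall i n, ~ Q (i, n) -> t <= r i n) -> exists l, trace r Q K t l.
Proof.
elim=> {K t} [K t norings|K t i s iK [n rs] st smax _ IH] Qt.
  by exists [::] => i n iK _; apply: (norings i) => //; exists n.
have Qs i' n' : ~ Q (i', n') -> s <= r i' n'.
  by move=> /Qt; apply: le_trans; apply: ltW; case/andP: st.
have [l tl] := IH Qs.
exists ((i, n) :: l); rewrite /= rs; split => //.
  split => //; apply: contrapT => /Qt; rewrite rs leNgt.
  by case/andP: st => _ ->.
by move=> i' n' iK' _ rt; apply: (smax _ _ iK' _ rt); exists n'.
Qed.

(** A terminating exploration meets each ring of its initial set, so causality
    excludes that rings accumulate. *)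
Lemma explored_finite (ring : L -> R -> Prop) K t : explored N ring K t ->
  forall i, i \in K -> exists l : seq R,
    forall u, ring i u -> 0 < u < t -> u \in l.
Proof.
elim=> {K t} [K t norings|K t i s iK rs st smax _ IH] j jK.
  by exists [::] => u /norings nu ut; case: (nu jK).
have [|l lP] := IH j; first by rewrite in_fsetU jK.
exists (s :: l) => u ju /andP[u0 ut]; rewrite inE.
have := smax _ _ jK ju ut; rewrite le_eqVlt => /orP[-> //|us].
by rewrite lP ?orbT // u0.
Qed.

Lemma trace_labels r Q K t l : trace r Q K t l -> forall jn, jn \in l -> Q jn.
Proof.
elim: l K t => // -[i n] l IH K t /= [[_ Qi] _ _ /IH h] jn.
by rewrite inE => /orP[/eqP ->|/h].
Qed.

Variables (s : R -> L -> A) (r : L -> nat -> R)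
  (V : forall j : L, nat -> {ffun {ffun N j -> A} -> A}).
Hypothesis jumps : forall j n, exists2 l : {ffun N j -> A},
  left_limit s (r j n) l & s (r j n) j = V j n l.
Hypothesis constant : forall j u t, 0 <= u <= t ->
  (forall n, ~ (u < r j n <= t)) -> s t j = s u j.

Lemma jump_value j n u : 0 <= u < r j n ->
  (forall i n', i \in N j -> ~ (u < r i n' < r j n)) ->
  s (r j n) j = V j n (restr (N j) (s u)).
Proof.
move=> /andP[u0 ur] noring; have [l ll ->] := jumps j n; congr (V j n _).
apply/ffunP => i; rewrite ffunE.
have lli : \forall v \near (r j n)^'-, s v (val i) = l i by exact: ll.
have near_u : \forall v \near (r j n)^'-, u < v < r j n.
  near=> v; apply/andP; split; last by near: v; exact: nbhs_left_lt.
  by near: v; exact: nbhs_left_gt.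
have : \forall v \near (r j n)^'-, l i = s u (val i).
  near=> v.
  have <- : s v (val i) = l i by near: v.
  have /andP[uv vr] : u < v < r j n by near: v.
  apply: constant; first by rewrite u0 ltW.
  move=> n' /andP[h1 h2]; apply: (noring (val i) n'); first exact: valP.
  by rewrite h1 (le_lt_trans h2).
by move=> /filter_ex[].
Unshelve. all: by end_near. Qed.

Hypothesis no_ties : forall i i' n n', i != i' -> r i n != r i' n'.

(** The exploration determines the state: at its earliest time the state on the
    explored set is the initial one, and between two consecutive rings met
    nothing happens on the set that is explored at that stage. *)
Lemma trace_sound Q l K t : 0 < t -> (forall i n, ~ Q (i, n) -> t <= r i n) ->
  trace r Q K t l -> exists u, [/\ 0 <= u < t,
    forall i n, i \in K -> ~ (u < r i n < t) &
    forall i, i \in K -> s u i = replay V (s 0) l i].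
Proof.
elim: l K t => [|[i0 n0] l IH] K t t0 Qt /=.
  move=> norings; exists 0; split => //; first by rewrite lexx.
  move=> i n iK h; apply: (norings i n iK) => //; apply: contrapT => /Qt.
  by rewrite leNgt; case/andP: h => _ ->.
move=> [[iK Qi] /andP[r0 rt] rmax].
have Qr i n : ~ Q (i, n) -> r i0 n0 <= r i n.
  by move=> /Qt; exact/le_trans/ltW.
move=> /(IH _ _ r0 Qr)[u [/andP[u0 ur] noring su]].
exists (r i0 n0); split; first by rewrite (ltW r0).
- move=> i n iK' /andP[h1 h2]; have [Qin|/Qt] := pselect (Q (i, n)).
    by have := rmax _ _ iK' Qin h2; rewrite leNgt h1.
  by rewrite leNgt h2.
move=> i iK'; rewrite /set_site; case: eqP => [->|/eqP ii0].
  rewrite (@jump_value i0 n0 u) ?u0 //; last first.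
    by move=> j n jN; apply: noring; rewrite in_fsetU jN orbT.
  congr (V _ _ _); apply/ffunP => j; rewrite !ffunE su // in_fsetU.
  by rewrite (valP j) orbT.
rewrite -su ?in_fsetU ?iK' //; apply: constant; first by rewrite u0 ltW.
move=> n /andP[h1]; rewrite le_eqVlt => /orP[/eqP h2|h2].
  by have := no_ties n n0 ii0; rewrite h2 eqxx.
by apply: (noring i n); rewrite ?in_fsetU ?iK' // h1.
Qed.

Lemma trace_state Q l i t : 0 < t -> (forall j n, ~ Q (j, n) -> t <= r j n) ->
  (forall n, r i n != t) ->
  trace r Q [fset i]%fset t l -> s t i = replay V (s 0) l i.
Proof.
move=> t0 Qt nt /(trace_sound t0 Qt)[u [/andP[u0 ut] noring <-]]; last first.
  by rewrite in_fset1.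
apply: constant; first by rewrite u0 ltW.
move=> n /andP[h1]; rewrite le_eqVlt (negbTE (nt n)) /= => h2.
by apply: (noring i n); rewrite ?in_fset1 // h1.
Qed.

End Trajectory.

Arguments trace {R L} N r Q K t l.

(** * Almost sure events and probabilities *)

Section CountableLogic.
Context {d : measure_display} {T : measurableType d}.

Lemma measurable_forall (I : countType) (E : I -> set T) :
  (forall i, measurable (E i)) -> measurable [set w | forall i, E i w].
Proof.
move=> mE; rewrite (_ : [set _ | _] = ~` \bigcup_i ~` E i); last first.
  apply/seteqP; split => w /=.
    by move=> h [i _]; apply.
  by move=> h i; apply: contrapT => nE; apply: h; exists i.
apply: measurableC; apply: countable_bigcupT_measurable => // i.
exact: measurableC.
Qed.

Lemma measurable_exists (I : countType) (E : I -> set T) :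
  (forall i, measurable (E i)) -> measurable [set w | exists i, E i w].
Proof.
move=> mE; rewrite (_ : [set _ | _] = \bigcup_i E i); last first.
  by apply/seteqP; split => w /= [i]; [exists i|move=> _ ?; exists i].
exact: countable_bigcupT_measurable.
Qed.

Lemma measurable_imply (C : Prop) (E : set T) : (C -> measurable E) ->
  measurable [set w | C -> E w].
Proof.
move=> mE; have [c|nc] := pselect C.
  rewrite (_ : [set _ | _] = E); first exact: mE.
  by apply/seteqP; split => w //=; exact.
by rewrite (_ : [set _ | _] = setT) //; apply/seteqP; split => w //= _ /nc.
Qed.

Lemma measurable_conj (C : Prop) (E : set T) : (C -> measurable E) ->
  measurable [set w | C /\ E w].
Proof.
move=> mE; have [c|nc] := pselect C.
  rewrite (_ : [set _ | _] = E); first exact: mE.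
  by apply/seteqP; split => w //= [].
by rewrite (_ : [set _ | _] = set0) //; apply/seteqP; split => w //= [].
Qed.

Context {R : realType} (P : probability T R).

Lemma ae_forall_countable (I : countType) (E : I -> T -> Prop) :
  (forall i, {ae P, forall w, E i w}) -> {ae P, forall w, forall i, E i w}.
Proof.
move=> aeE.
have : {ae P, forall w, forall n : nat,
    if (choice.unpickle n : option I) is Some i then E i w else True}.
  apply: ae_foralln => n; case: (choice.unpickle n : option I) => [i|]; first exact: aeE.
  exact: filterE.
by apply: filterS => w h i; have := h (choice.pickle i); rewrite choice.pickleK.
Qed.

Lemma ae_and (E F : T -> Prop) : {ae P, forall w, E w} ->
  {ae P, forall w, F w} -> {ae P, forall w, E w /\ F w}.
Proof. by move=> aE aF; apply: filterS2 aE aF => w. Qed.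

Lemma ae_eq_prob (E E' : set T) : measurable E -> measurable E' ->
  {ae P, forall w, E w <-> E' w} -> P E = P E'.
Proof.
move=> mE mE' [B [mB PB0 BE]].
have sub F F' : measurable F -> measurable F' -> (forall w, F w -> F' w \/ B w) ->
    (P F <= P F')%E.
  move=> mF mF' FF'; apply: (@le_trans _ _ (P (F' `|` B))).
    by rewrite le_measure ?inE //; exact: measurableU.
  by apply: le_trans (measureU2 _ mF' mB) _; rewrite [X in (_ + X)%E]PB0 adde0.
apply/eqP; rewrite eq_le !sub // => w Ew.
  have [Bw|nBw] := pselect (B w); [by right|left].
  by apply: contrapT => nE; apply/nBw/BE => /= -[]; tauto.
have [Bw|nBw] := pselect (B w); [by right|left].
by apply: contrapT => nE; apply/nBw/BE => /= -[]; tauto.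
Qed.

Lemma prob_partition_scale (D E F : nat -> set T) (c : R) : 0 <= c ->
  (forall n, measurable (D n)) -> (forall n, measurable (E n)) ->
  (forall n, measurable (F n)) -> trivIset setT D ->
  (forall n, P (D n `&` E n) = (c%:E * P (D n `&` F n))%E) ->
  P (\bigcup_n (D n `&` E n)) = (c%:E * P (\bigcup_n (D n `&` F n)))%E.
Proof.
move=> c0 mD mE mF tD EF.
have tI G : trivIset setT (fun n => D n `&` G n).
  by move=> i j _ _ [w [[Di _] [Dj _]]]; apply: tD => //; exists w.
rewrite !measure_semi_bigcup //; try (by move=> i; exact: measurableI);
  try (by apply: bigcup_measurable => i _; exact: measurableI).
rewrite -nneseriesZl //.
by apply: eq_eseriesr => n _; exact: EF.
Qed.

Lemma prob_fin_num (E : set T) : measurable E -> P E \is a fin_num.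
Proof. by move=> mE; exact: fin_num_measure. Qed.

Lemma negligible_of_small (E : set T) (F : nat -> set T) (c : R) :
  (forall n, measurable (F n)) -> (forall n, E `<=` F n) ->
  (forall n, (P (F n) <= (c / n.+1%:R)%:E)%E) -> P.-negligible E.
Proof.
move=> mF EF PF; exists (\bigcap_n F n).
have mI : measurable (\bigcap_n F n) by exact: bigcapT_measurable.
split => //; last by move=> w Ew n _; exact: EF.
apply/eqP; rewrite eq_le measure_ge0 andbT leNgt; apply/negP => lt.
pose q := fine (P (\bigcap_n F n)).
have qE : P (\bigcap_n F n) = q%:E by rewrite fineK // prob_fin_num.
have q0 : 0 < q by move: lt; rewrite qE lte_fin.
have le n : q <= c / n.+1%:R.
  rewrite -lee_fin -qE; apply: le_trans (PF n).
  by rewrite le_measure ?inE //; exact: bigcap_inf.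
have [n cn] : exists n : nat, c / q < n%:R.
  exists (Num.bound `|c / q|); apply: le_lt_trans (ler_norm _) _.
  exact: archi_boundP.
have := le n; rewrite ler_pdivlMr ?ltr0n // mulrC -ler_pdivlMr // leNgt.
by rewrite (lt_trans cn) // ltr_nat.
Qed.

End CountableLogic.

Lemma one_sub_expRN_bound {R : realType} (h : R) : 0 <= h ->
  h - h ^+ 2 <= 1 - expR (- h) <= h.
Proof.
move=> h0; apply/andP; split; last first.
  have := @expR_ge1Dx R (- h); lra.
have h1 : 0 < 1 + h by lra.
have : expR (- h) <= (1 + h)^-1.
  by rewrite expRN lef_pV2 ?posrE ?expR_gt0 // expR_ge1Dx.
move=> le; suff : (1 + h)^-1 <= 1 - h + h ^+ 2 by lra.
rewrite -[_^-1]mul1r ler_pdivrMr //; nra.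
Qed.

(** * Expectations of bounded functions *)

Section BoundedExpectation.
Context {R : realType} {d : measure_display} {T : measurableType d}
  (P : probability T R).

Definition bounded_mfun (f : T -> R) : Prop :=
  measurable_fun setT f /\ exists M : R, forall w, `|f w| <= M.

Definition mean (f : T -> R) : R := \int[P]_w f w.

Lemma bounded_mfun_integrable f : bounded_mfun f -> P.-integrable setT (EFin \o f).
Proof.
move=> [mf [M fM]]; apply: (@measurable_bounded_integrable _ _ _ P) => //.
  by rewrite (le_lt_trans (probability_le1 _ _)) // ltry.
exists M; split; first exact: num_real.
by move=> x Mx w _; apply: le_trans (fM w) (ltW Mx).
Qed.

Lemma bounded_mfun_cst c : bounded_mfun (fun=> c).
Proof. by split => //; exists `|c|. Qed.

Lemma bounded_mfun_indic E : measurable E -> bounded_mfun \1_E.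
Proof.
move=> mE; split; first exact: measurable_indic.
by exists 1 => w; rewrite indicE; case: (w \in E); rewrite ?normr1 ?normr0.
Qed.

Lemma bounded_mfunD f g : bounded_mfun f -> bounded_mfun g -> bounded_mfun (fun w => f w + g w).
Proof.
move=> [mf [M fM]] [mg [M' gM]]; split; first exact: measurable_funD.
by exists (M + M') => w; apply: le_trans (ler_normD _ _) (lerD _ _).
Qed.

Lemma bounded_mfunM f g : bounded_mfun f -> bounded_mfun g -> bounded_mfun (fun w => f w * g w).
Proof.
move=> [mf [M fM]] [mg [M' gM]]; split; first exact: measurable_funM.
by exists (M * M') => w; rewrite normrM ler_pM.
Qed.

Lemma bounded_mfunZ c f : bounded_mfun f -> bounded_mfun (fun w => c * f w).
Proof. exact/bounded_mfunM/bounded_mfun_cst. Qed.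

Lemma bounded_mfunB f g : bounded_mfun f -> bounded_mfun g -> bounded_mfun (fun w => f w - g w).
Proof.
move=> bf bg; have := bounded_mfunD bf (bounded_mfunZ (-1) bg).
by congr bounded_mfun; apply/funext => w; rewrite mulN1r.
Qed.

Lemma bounded_mfun_sum (I : Type) (s : seq I) (F : I -> T -> R) :
  (forall i, bounded_mfun (F i)) -> bounded_mfun (fun w => \sum_(i <- s) F i w).
Proof.
move=> bF; elim: s => [|i s IH].
  by rewrite (_ : (fun _ => _) = fun=> 0); [exact: bounded_mfun_cst|
    apply/funext => w; rewrite big_nil].
rewrite (_ : (fun _ => _) = fun w => F i w + \sum_(i <- s) F i w).
  exact: bounded_mfunD.
by apply/funext => w; rewrite big_cons.
Qed.

Lemma meanD f g : bounded_mfun f -> bounded_mfun g -> mean (fun w => f w + g w) = mean f + mean g.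
Proof. by move=> bf bg; apply: RintegralD => //; exact: bounded_mfun_integrable. Qed.

Lemma meanZ c f : bounded_mfun f -> mean (fun w => c * f w) = c * mean f.
Proof. by move=> bf; apply: RintegralZl => //; exact: bounded_mfun_integrable. Qed.

Lemma meanB f g : bounded_mfun f -> bounded_mfun g -> mean (fun w => f w - g w) = mean f - mean g.
Proof. by move=> bf bg; apply: RintegralB => //; exact: bounded_mfun_integrable. Qed.

Lemma mean_cst c : mean (fun=> c) = c.
Proof.
by rewrite /mean Rintegral_cst // (congr1 fine (probability_setT P)) mulr1.
Qed.

Lemma mean_sum (I : Type) (s : seq I) (F : I -> T -> R) :
  (forall i, bounded_mfun (F i)) ->
  mean (fun w => \sum_(i <- s) F i w) = \sum_(i <- s) mean (F i).
Proof.
move=> bF; elim: s => [|i s IH].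
  by rewrite big_nil -[RHS](mean_cst 0); congr mean; apply/funext => w; rewrite big_nil.
rewrite big_cons -IH -meanD //; last exact: bounded_mfun_sum.
by congr mean; apply/funext => w; rewrite big_cons.
Qed.

Lemma mean_indic E : measurable E -> (mean \1_E)%:E = P E.
Proof.
move=> mE; rewrite /mean /Rintegral fineK; first by rewrite integral_indic // setIT.
by rewrite integral_indic // setIT fin_num_measure.
Qed.

Lemma le_mean f g : bounded_mfun f -> bounded_mfun g -> (forall w, f w <= g w) -> mean f <= mean g.
Proof. by move=> bf bg fg; apply: le_Rintegral => //; exact: bounded_mfun_integrable. Qed.

Lemma bounded_mfun_norm f : bounded_mfun f -> bounded_mfun (fun w => `|f w|).
Proof.
move=> [mf [M fM]]; split; first exact: measurableT_comp.
by exists M => w; rewrite normr_id.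
Qed.

Lemma norm_mean f : bounded_mfun f -> `|mean f| <= mean (fun w => `|f w|).
Proof. by move=> bf; apply: le_normr_Rintegral => //; exact: bounded_mfun_integrable. Qed.

Lemma norm_mean_le f M : bounded_mfun f -> (forall w, `|f w| <= M) -> `|mean f| <= M.
Proof.
move=> bf fM; apply: le_trans (norm_mean bf) _; rewrite -[leRHS](mean_cst M).
apply: le_mean => //; [exact: bounded_mfun_norm|exact: bounded_mfun_cst].
Qed.

Lemma norm_mean_small f B M c : bounded_mfun f -> measurable B -> 0 <= M ->
  (forall w, `|f w| <= M) -> {ae P, forall w, ~ B w -> f w = 0} ->
  (P B <= c%:E)%E -> `|mean f| <= M * c.
Proof.
move=> bf mB M0 fM [Z [mZ PZ0 ZP]] PB.
have mBZ : measurable (B `|` Z) by exact: measurableU.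
apply: le_trans (norm_mean bf) _.
apply: (@le_trans _ _ (mean (fun w => M * \1_(B `|` Z) w))).
  apply: le_mean; [exact: bounded_mfun_norm|apply: bounded_mfunZ; exact: bounded_mfun_indic|move=> w].
  rewrite indicE; have [_|nBZ] := boolP (w \in _); first by rewrite mulr1.
  rewrite mulr0 (_ : f w = 0) ?normr0 //.
  have nZ : ~ Z w by move=> Zw; move/negP: nBZ; apply; rewrite inE; right.
  have nB : ~ B w by move=> Bw; move/negP: nBZ; apply; rewrite inE; left.
  by apply: contrapT => nf; apply/nZ/ZP => /(_ nB).
rewrite meanZ; last exact: bounded_mfun_indic.
apply: ler_wpM2l => //; rewrite -lee_fin mean_indic //; apply: le_trans PB.
apply: le_trans (measureU2 _ mB mZ) _.
by rewrite [X in (_ + X)%E]PZ0 adde0.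
Qed.

End BoundedExpectation.

(** * Local functions *)

Section LocalFunctions.
Context {R : realType} {dA : Order.disp_t} {A : finTBOrderType dA} {L : countType}.

Definition depends_on (K : {fset L}) (f : (L -> A) -> R) : Prop :=
  forall s s' : L -> A, (forall j, j \in K -> s j = s' j) -> f s = f s'.

Definition depends_on2 (K : {fset L}) (F : (L -> A) -> (L -> A) -> R) : Prop :=
  forall s s' u u' : L -> A, (forall j, j \in K -> s j = s' j) ->
    (forall j, j \in K -> u j = u' j) -> F s u = F s' u'.

Definition extend (K : {fset L}) (c : {ffun K -> A}) (i : L) : A :=
  oapp c \bot%O (insub i).

Lemma extend_restr (K : {fset L}) (s : L -> A) i : i \in K ->
  extend (restr K s) i = s i.
Proof. by move=> iK; rewrite /extend insubT /= ffunE. Qed.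

Lemma depends_onW (K K' : {fset L}) f : (K `<=` K')%fset ->
  depends_on K f -> depends_on K' f.
Proof. by move=> /fsubsetP KK' fK s s' ss'; apply: fK => j /KK'; exact: ss'. Qed.

Lemma local_bounded (K : {fset L}) f : depends_on K f ->
  exists M : R, forall s, `|f s| <= M.
Proof.
move=> fK; exists (\sum_(c : {ffun K -> A}) `|f (extend c)|) => s.
rewrite (fK s (extend (restr K s))); last by move=> j jK; rewrite extend_restr.
by rewrite (bigD1 (restr K s)) //= lerDl sumr_ge0.
Qed.

End LocalFunctions.

(** * What the sources determine *)

Section Process.
Context {R : realType} {dA : Order.disp_t} {A : finTBOrderType dA}
  {L : countType} {N : L -> {fset L}} {d : measure_display}
  {T : measurableType d} (P : probability T R) (zeta : R -> T -> L -> A)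
  (W : L -> nat -> {RV P >-> R})
  (U : forall j : L, nat -> T -> {ffun {ffun N j -> A} -> A})
  (p : transition_family R A N).
Arguments p : clear implicits.

Hypothesis zeta_meas : forall t j a, 0 <= t -> measurable [set w | zeta t w j = a].
Hypothesis W_law : forall j n B, measurable B ->
  distribution P (W j n) B = exponential_prob 1 B.
Hypothesis U_law : forall j n s b, measurable [set w | U j n w s = b] /\
  P [set w | U j n w s = b] = (p j s b)%:E.

Let src := sources (zeta 0) (fun j n => W j n) U.

Hypothesis src_indep : mutually_independent P src.

Let label : choiceType := option (L * nat + L * nat)%type.

Definition ringt (j : L) (n : nat) (w : T) : R :=
  ring_time (fun j n => W j n) j n w.

Let srcI i : setI_closed (src i).
Proof.
case: i => [[[j n]|[j n]]|] /= E F.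
- move=> [B mB <-] [C mC <-]; exists (B `&` C) => //; exact: measurableI.
- by move=> [B _ <-] [C _ <-]; exists (B `&` C).
- exact: (@measurableI _ (g_sigma_algebraType _)).
Qed.

Let srcT i : src i setT.
Proof.
case: i => [[[j n]|[j n]]|] /=.
- by exists setT.
- by exists setT.
- exact: (@measurableT _ (g_sigma_algebraType _)).
Qed.

Let mU j n v : measurable [set w | U j n w = v].
Proof.
rewrite (_ : [set _ | _] = [set w | forall s, U j n w s = v s]); last first.
  apply/seteqP; split => w /=; first by move=> ->.
  by move=> h; apply/ffunP.
by apply: measurable_forall => s; have [] := @U_law j n s (v s).
Qed.

Let src_meas i : src i `<=` measurable.
Proof.
case: i => [[[j n]|[j n]]|] /= E.
- by move=> [B mB <-]; rewrite -[X in measurable X]setTI; exact: measurable_funPT.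
- move=> [B _ <-].
  rewrite (_ : _ @^-1` _ = [set w | exists v, B v /\ U j n w = v]); last first.
    apply/seteqP; split => w /=; first by move=> Bw; exists (U j n w).
    by move=> [v [Bv ->]].
  by apply: measurable_exists => v; apply: measurable_conj => _; exact: mU.
- apply: smallest_sub; first exact: sigma_algebra_measurable.
  by move=> _ [j [a ->]]; exact: zeta_meas.
Qed.

(** [Q] is a set of rings; for each of them both the waiting time that ends with
    it and the response used at it are included, and always the initial state. *)
Definition past (Q : set (L * nat)) : set label :=
  fun i => match i with
           | None => True
           | Some (inl jn) => Q jn
           | Some (inr jn) => Q jn
           end.

Definition known (J : set label) : set (set T) := joint_sigma src J.

Local Notation alg J := (g_sigma_algebraType (\bigcup_(i in J) src i)).

Lemma known_meas J : known J `<=` measurable.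
Proof. exact: joint_sigma_meas. Qed.

Lemma known_indep J1 J2 A1 A2 : J1 `&` J2 = set0 ->
  known J1 A1 -> known J2 A2 -> P (A1 `&` A2) = (P A1 * P A2)%E.
Proof. exact: joint_sigma_indep. Qed.

Lemma known_wait (J : set label) j n : J (Some (inl (j, n))) ->
  measurable_fun (setT : set (alg J)) (W j n : alg J -> R).
Proof.
move=> Jjn _ B mB; rewrite setTI; apply: (joint_sigma_in Jjn); exact: imageP.
Qed.

Lemma known_response (J : set label) j n s b : J (Some (inr (j, n))) ->
  known J [set w | U j n w s = b].
Proof.
move=> Jjn; apply: (joint_sigma_in Jjn).
by exists [set v | v s = b].
Qed.

Lemma known_init (J : set label) j a : J None -> known J [set w | zeta 0 w j = a].
Proof.
move=> JN; apply: (joint_sigma_in JN) => /=.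
by apply: sub_sigma_algebra; exists j, a.
Qed.

Lemma known_ringt (J : set label) j n :
  (forall k, (k <= n)%N -> J (Some (inl (j, k)))) ->
  measurable_fun (setT : set (alg J)) (ringt j n : alg J -> R).
Proof.
move=> Jj; apply: (@measurable_sum _ (alg J) R _ _ _ (fun k : 'I_n.+1 => W j k)).
by move=> k; apply: known_wait; apply: Jj; rewrite -ltnS.
Qed.

Definition down_closed (Q : set (L * nat)) : Prop :=
  forall j n k, (k <= n)%N -> Q (j, n) -> Q (j, k).

Lemma known_trace (Q : set (L * nat)) K (t : T -> R) l : down_closed Q ->
  measurable_fun (setT : set (alg (past Q))) (t : alg (past Q) -> R) ->
  known (past Q) [set w | trace N (fun j n => ringt j n w) Q K (t w) l].
Proof.
move=> Qd; elim: l K t => [|[i n] l IH] K t mt /=.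
  apply: (@measurable_forall _ (alg (past Q))) => i.
  apply: (@measurable_forall _ (alg (past Q))) => n.
  apply: measurable_imply => _; apply: measurable_imply => Qin.
  have mr : measurable_fun (setT : set (alg (past Q))) (ringt i n : alg _ -> R).
    by apply: known_ringt => k kn; exact: Qd Qin.
  rewrite [X in measurable X](_ : _ = ~` ([set w | 0 < ringt i n w] `&`
                                 [set w | ringt i n w < t w])); last first.
    by apply/seteqP; split => w /= h; [move=> [h1 h2]; apply: h; rewrite h1|
      move=> /andP[h1 h2]; apply: h].
  apply: measurableC; apply: measurableI; apply: measurable_set_lt => //.
rewrite (_ : [set _ | _] = [set w | (i \in K /\ Q (i, n)) /\
  ((0 < ringt i n w /\ ringt i n w < t w) /\
   ((forall i' n', i' \in K -> Q (i', n') -> ringt i' n' w < t w ->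
      ringt i' n' w <= ringt i n w) /\
    trace N (fun j n => ringt j n w) Q (K `|` N i)%fset (ringt i n w) l))]);
  last first.
  apply/seteqP; split => w /=.
    by move=> [h1 /andP[h2 h3] h4 h5].
  by move=> [h1 [[h2 h3] [h4 h5]]]; split => //; rewrite h2.
apply: (@measurable_conj _ (alg (past Q))) => -[iK Qin].
have mr i' n' : Q (i', n') ->
    measurable_fun (setT : set (alg (past Q))) (ringt i' n' : alg _ -> R).
  by move=> Qin'; apply: known_ringt => k kn; exact: Qd Qin'.
apply: (@measurableI _ (alg (past Q))).
  apply: (@measurableI _ (alg (past Q))).
    by apply: (@measurable_set_lt _ _ (alg (past Q)) (fun=> 0)) => //; exact: mr.
  by apply: (@measurable_set_lt _ _ (alg (past Q))) => //; exact: mr.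
apply: (@measurableI _ (alg (past Q))); last first.
  by apply: IH; exact: mr.
apply: (@measurable_forall _ (alg (past Q))) => i'.
apply: (@measurable_forall _ (alg (past Q))) => n'.
apply: measurable_imply => _; apply: measurable_imply => Qin'.
rewrite [X in measurable X](_ : _ = ~` [set w | ringt i' n' w < t w] `|`
  [set w | ringt i' n' w <= ringt i n w]); last first.
  apply/seteqP; split => w /=.
    by move=> h; have [/h|] := pselect (ringt i' n' w < t w); [right|left].
  by move=> [nlt /nlt|].
apply: measurableU.
  by apply: measurableC; apply: measurable_set_lt => //; exact: mr.
by apply: measurable_set_le; exact: mr.
Qed.

Lemma known_replay (Q : set (L * nat)) (l : seq (L * nat)) i a :
  (forall jn, jn \in l -> Q jn) ->
  known (past Q) [set w | replay (fun j n => U j n w) (zeta 0 w) l i = a].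
Proof.
elim: l i a => [|[j n] l IH] i a Ql /=; first exact: known_init.
have {}IH i' a' := IH i' a' (fun jn h => Ql jn (mem_behead (s := (j, n) :: l) h)).
rewrite /set_site; case: eqP => [_|_]; last exact: IH.
rewrite (_ : [set _ | _] = [set w | exists v : {ffun N j -> A},
  U j n w v = a /\ forall k : N j,
    replay (fun j n => U j n w) (zeta 0 w) l (val k) = v k]); last first.
  apply/seteqP; split => w /=.
    move=> Ua; exists (restr (N j) (replay (fun j n => U j n w) (zeta 0 w) l)).
    by split => // k; rewrite ffunE.
  move=> [v [<- rv]]; congr (U j n w _); apply/ffunP => k.
  by rewrite ffunE; exact: rv.
apply: (@measurable_exists _ (alg (past Q))) => v.
apply: (@measurableI _ (alg (past Q))).
  by apply: known_response; apply: Ql; rewrite inE eqxx.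
by apply: (@measurable_forall _ (alg (past Q))) => k; exact: IH.
Qed.

(** * Rings during a short time *)

(** For fixed [j] and [t] these events are disjoint and, as rings do not
    accumulate, exhaust almost everything; on each of them the number [n] of
    rings up to [t] is known, and so is the waiting time that is running. *)
Definition first_after j n t : set T :=
  [set w | (forall k, (k < n)%N -> ringt j k w <= t) /\ t < ringt j n w].

Definition rings_within j t h : set T :=
  \bigcup_n (first_after j n t `&` [set w | ringt j n w <= t + h]).

Definition rings_twice j t h : set T :=
  \bigcup_n (first_after j n t `&`
    ([set w | ringt j n w <= t + h] `&` [set w | W j n.+1 w <= h])).

Lemma known_before (J : set label) j n t :
  (forall k, (k < n)%N -> J (Some (inl (j, k)))) ->
  known J [set w | forall k, (k < n)%N -> ringt j k w <= t].
Proof.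
move=> Jk; apply: (@measurable_forall _ (alg J)) => k.
apply: measurable_imply => kn.
apply: (@measurable_set_le _ _ (alg J) _ (fun=> t)) => //.
by apply: known_ringt => k' k'k; apply: Jk; exact: leq_ltn_trans k'k kn.
Qed.

Lemma known_first_after (J : set label) j n t :
  (forall k, (k <= n)%N -> J (Some (inl (j, k)))) -> known J (first_after j n t).
Proof.
move=> Jk; apply: (@measurableI _ (alg J)).
  by apply: known_before => k kn; apply: Jk; exact: ltnW.
apply: (@measurable_set_lt _ _ (alg J) (fun=> t)) => //.
exact: known_ringt.
Qed.

Lemma known_hit (J : set label) j n t :
  (forall k, (k <= n)%N -> J (Some (inl (j, k)))) ->
  known J [set w | ringt j n w <= t].
Proof.
move=> Jk; apply: (@measurable_set_le _ _ (alg J) _ (fun=> t)) => //.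
exact: known_ringt.
Qed.

Lemma first_after_meas j n t : measurable (first_after j n t).
Proof. by apply: (@known_meas setT); exact: known_first_after. Qed.

Lemma hit_meas j n t : measurable [set w | ringt j n w <= t].
Proof. by apply: (@known_meas setT); exact: known_hit. Qed.

Lemma trivIset_first_after j t : trivIset setT (fun n => first_after j n t).
Proof.
move=> n m _ _ [w [[bn an] [bm am]]]; apply/eqP; rewrite eqn_leq.
apply/andP; split; rewrite leqNgt; apply/negP => lt.
  by have := bn _ lt; rewrite leNgt am.
by have := bm _ lt; rewrite leNgt an.
Qed.

Lemma ring_prob (J : set label) j n E t h : 0 <= t -> 0 <= h ->
  ~ J (Some (inl (j, n))) -> (forall k, (k < n)%N -> J (Some (inl (j, k)))) ->
  known J E ->
  P (first_after j n t `&` (E `&` [set w | ringt j n w <= t + h])) =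
  ((1 - expR (- h))%:E * P (first_after j n t `&` E))%E.
Proof.
move=> t0 h0 nJ Jk kE.
pose X w := \sum_(k < n) W j k w.
have rE w : ringt j n w = X w + W j n w by rewrite /ringt /ring_time big_ord_recr.
pose B := E `&` [set w | forall k, (k < n)%N -> ringt j k w <= t].
have kB : known J B by apply: (@measurableI _ (alg J)) => //; exact: known_before.
have BX w : B w -> X w <= t.
  move=> [_ bw]; rewrite /X; case: n bw {nJ Jk X rE B kB} => [|n] bw.
    by rewrite big_ord0.
  exact: (bw n).
have mX : measurable_fun (setT : set (alg J)) (X : alg J -> R).
  apply: (@measurable_sum _ (alg J) R _ _ _ (fun k : 'I_n => W j k)) => k.
  by apply: known_wait; apply: Jk.
have ind E' C : known J E' -> measurable C ->
    P (E' `&` W j n @^-1` C) = (P E' * P (W j n @^-1` C))%E.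
  move=> kE' mC; apply: (@known_indep J [set Some (inl (j, n))]) => //.
    by apply/seteqP; split => // i /= [Ji iE]; apply: nJ; rewrite -iE.
  by apply: (@joint_sigma_in _ _ _ _ _ (Some (inl (j, n)))) => //; exact: imageP.
have := memoryless_ring (@known_meas J) ind (@W_law j n) mX kB BX h0.
rewrite (_ : B `&` _ = first_after j n t `&`
                       (E `&` [set w | ringt j n w <= t + h])); last first.
  apply/seteqP; split => w /=; rewrite -rE.
    by move=> [[Ew bw] /andP[h1 h2]].
  by move=> [[bw h1] [Ew h2]]; rewrite h1.
move=> ->; congr (_ * P _)%E; apply/seteqP; split => w /=; rewrite -rE.
  by move=> [[Ew bw] h1].
by move=> [[bw h1] Ew].
Qed.

Lemma rings_within_le j t h : 0 <= t -> 0 <= h -> (P (rings_within j t h) <= h%:E)%E.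
Proof.
move=> t0 h0.
have /andP[h1 h2] := one_sub_expRN_bound h0.
have c0 : 0 <= 1 - expR (- h) by rewrite subr_ge0 -expR0 ler_expR oppr_le0.
rewrite /rings_within (@prob_partition_scale _ _ _ P _ _ (fun=> setT) (1 - expR (- h))) //.
- apply: (@le_trans _ _ ((1 - expR (- h))%:E * 1)%E).
    rewrite lee_pmul // ?lee_fin //; apply: probability_le1.
    apply: bigcup_measurable => n _; rewrite setIT; exact: first_after_meas.
  by rewrite mule1 lee_fin.
- by move=> n; exact: first_after_meas.
- by move=> n; exact: hit_meas.
- exact: trivIset_first_after.
- move=> n.
  rewrite -(@ring_prob [set i | exists2 k, (k < n)%N & i = Some (inl (j, k))]) //.
  + by rewrite setTI.
  + by move=> /= [k kn []] kE; rewrite kE ltnn in kn.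
  + by move=> k kn; exists k.
  + exact: (@measurableT _ (alg _)).
Qed.

Lemma known_rings_within (J : set label) j t h :
  (forall k, J (Some (inl (j, k)))) -> known J (rings_within j t h).
Proof.
move=> Jk; apply: (@bigcup_measurable _ (alg J)) => n _.
apply: (@measurableI _ (alg J)); first exact: known_first_after.
exact: known_hit.
Qed.

Lemma rings_within_meas j t h : measurable (rings_within j t h).
Proof. by apply: (@known_meas setT); exact: known_rings_within. Qed.

Lemma rings_two_sites_le i j t h : i != j -> 0 <= t -> 0 <= h ->
  (P (rings_within i t h `&` rings_within j t h) <= (h ^+ 2)%:E)%E.
Proof.
move=> ij t0 h0.
rewrite (@known_indep [set l | exists k, l = Some (inl (i, k))]
                      [set l | exists k, l = Some (inl (j, k))]).
- by rewrite expr2 EFinM lee_pmul // rings_within_le.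
- apply/seteqP; split => // l /= [[k ->] [k' []]] e.
  by rewrite e eqxx in ij.
- by apply: known_rings_within => k; exists k.
- by apply: known_rings_within => k; exists k.
Qed.

Lemma wait_gt j n h : 0 <= h -> P [set w | h < W j n w] = (expR (- h))%:E.
Proof.
move=> h0; rewrite -(exponential_tail (@W_law j n) h0).
by congr (P _); apply/seteqP; split => w /=; rewrite in_itv /= andbT.
Qed.

Lemma wait_gt_meas j n h : measurable [set w | h < W j n w].
Proof. exact: (@measurable_set_lt _ _ _ (fun=> h)). Qed.

Lemma wait_le j n h : 0 <= h ->
  P [set w | W j n w <= h] = (1 - expR (- h))%:E.
Proof.
move=> h0; rewrite (_ : [set _ | _] = ~` [set w | h < W j n w]); last first.
  by apply/seteqP; split => w /=; rewrite leNgt; [move/negP|move=> /negP].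
by rewrite probability_setC ?wait_gt //; exact: wait_gt_meas.
Qed.

Lemma rings_twice_meas j t h : measurable (rings_twice j t h).
Proof.
apply: bigcup_measurable => n _; apply: measurableI; first exact: first_after_meas.
apply: measurableI; first exact: hit_meas.
exact: (@measurable_set_le _ _ _ _ (fun=> h)).
Qed.

Lemma rings_twice_le j t h : 0 <= t -> 0 <= h ->
  (P (rings_twice j t h) <= (h ^+ 2)%:E)%E.
Proof.
move=> t0 h0; have /andP[h1 h2] := one_sub_expRN_bound h0.
have c0 : 0 <= 1 - expR (- h) by rewrite subr_ge0 -expR0 ler_expR oppr_le0.
have mW n : measurable [set w | W j n.+1 w <= h].
  exact: (@measurable_set_le _ _ _ _ (fun=> h)).
rewrite /rings_twice (@prob_partition_scale _ _ _ P _ _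
  (fun n => [set w | ringt j n w <= t + h]) (1 - expR (- h))) //.
- by rewrite expr2 EFinM lee_pmul // ?lee_fin //; exact: rings_within_le.
- by move=> n; exact: first_after_meas.
- by move=> n; apply: measurableI => //; exact: hit_meas.
- by move=> n; exact: hit_meas.
- exact: trivIset_first_after.
move=> n; rewrite setIA muleC -(wait_le j n.+1 h0).
apply: (@known_indep [set l | exists2 k, (k <= n)%N & l = Some (inl (j, k))]
                     [set Some (inl (j, n.+1))]).
- apply/seteqP; split => // l /= [[k kn ->] []] e.
  by rewrite e ltnn in kn.
- apply: (@measurableI _ (alg _)).
    by apply: known_first_after => k kn; exists k.
  by apply: known_hit => k kn; exists k.
- apply: (@joint_sigma_in _ _ _ _ _ (Some (inl (j, n.+1)))) => //=.
  by exists `]-oo, h]%classic.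
Qed.

Definition waits_pos (w : T) : Prop := forall j n, 0 < W j n w.

Lemma ae_waits_pos : {ae P, forall w, waits_pos w}.
Proof.
apply: (ae_forall_countable (I := L)) => j; apply: ae_foralln => n.
exists [set w | W j n w <= 0]; split.
- exact: (@measurable_set_le _ _ _ _ (fun=> 0)).
- by have := @wait_le j n 0 (lexx 0); rewrite oppr0 expR0 subrr.
- by move=> w /= /negP; rewrite -leNgt.
Qed.

Lemma ringtS j n w : ringt j n.+1 w = ringt j n w + W j n.+1 w.
Proof. by rewrite /ringt /ring_time big_ord_recr. Qed.

Lemma ringt_lt w j n m : waits_pos w -> (n < m)%N -> ringt j n w < ringt j m w.
Proof.
move=> pw; elim: m => // m IH; rewrite ltnS leq_eqVlt ringtS => /orP[/eqP ->|nm].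
  by rewrite ltrDl pw.
by rewrite (lt_trans (IH nm)) // ltrDl pw.
Qed.

Lemma ringt_le w j n m : waits_pos w -> (n <= m)%N -> ringt j n w <= ringt j m w.
Proof.
by move=> pw; rewrite leq_eqVlt => /orP[/eqP -> //|/(ringt_lt j pw)/ltW].
Qed.

Lemma ringt_gt0 w j n : waits_pos w -> 0 < ringt j n w.
Proof.
move=> pw; apply: lt_le_trans (ringt_le j pw (leq0n n)).
by rewrite /ringt /ring_time big_ord1 pw.
Qed.

Lemma first_after_ex w j n t : t < ringt j n w ->
  exists2 m, (m <= n)%N & first_after j m t w.
Proof.
move=> tn; have ex : exists m, t < ringt j m w by exists n.
case: (ex_minnP ex) => m tm mmin; exists m; first exact: mmin.
split => // k km; rewrite leNgt; apply/negP => /mmin.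
by rewrite leqNgt km.
Qed.

Lemma rings_within_ex w j n t h : waits_pos w -> t < ringt j n w <= t + h ->
  rings_within j t h w.
Proof.
move=> pw /andP[tn nh]; have [m mn fm] := first_after_ex tn.
exists m => //; split => //=; apply: le_trans nh; exact: ringt_le.
Qed.

(** A ring at [t] is a ring within [h] after [t - h], for all small [h]. *)
Lemma ae_no_ring_at j t : 0 < t -> {ae P, forall w, forall n, ringt j n w != t}.
Proof.
move=> t0; suff : {ae P, forall w, waits_pos w -> forall n, ringt j n w != t}.
  move=> h; apply: filterS2 ae_waits_pos h => w pw; exact.
pose h n : R := t / n.+1%:R.
have h0 n : 0 < h n by rewrite divr_gt0.
apply: (@negligible_of_small _ _ _ P _ (fun n => rings_within j (t - h n) (h n)) t).
- by move=> n; exact: rings_within_meas.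
- move=> n w /= /not_implyP[pw /existsNP[m /negP]]; rewrite negbK => /eqP mt.
  apply: (@rings_within_ex w j m) => //.
  by rewrite mt subrK lexx andbT gtrBl.
- move=> n; apply: rings_within_le; last exact: ltW.
  by rewrite subr_ge0 ler_pdivrMr // ler_peMr // ?ler1n // ltW.
Qed.

(** A common ring of two sites before time [M] falls in one of n cells of length
    M / n, each of which contains rings of both sites with probability at most
    (M / n)^2. *)
Lemma ae_no_ties : {ae P, forall w, forall i j n m, i != j ->
  ringt i n w != ringt j m w}.
Proof.
suff H i j (M : nat) : i != j -> {ae P, forall w, waits_pos w ->
    forall n m, ringt i n w = ringt j m w -> ~ (ringt i n w <= M.+1%:R)}.
  have : {ae P, forall w, forall i j (M : nat), i != j -> waits_pos w ->
      forall n m, ringt i n w = ringt j m w -> ~ (ringt i n w <= M.+1%:R)}.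
    apply: (ae_forall_countable (I := L)) => i.
    apply: (ae_forall_countable (I := L)) => j.
    apply: ae_foralln => M; case: (boolP (i != j)) => [ij|_].
      by have := @H i j M ij; apply: filterS => w h _.
    exact: filterE.
  apply: filterS2 ae_waits_pos => w pw h i j n m ij; apply/eqP => e.
  apply: (h i j (Num.bound `|ringt i n w|) ij pw n m e).
  apply: le_trans (ler_norm _) _; apply: ltW.
  by rewrite (lt_trans (archi_boundP _)) // ltr_nat.
move=> ij.
pose h n : R := M.+1%:R / n.+1%:R.
have h0 n : 0 < h n by rewrite divr_gt0.
pose C n k := rings_within i (h n *+ k) (h n) `&` rings_within j (h n *+ k) (h n).
have mC n k : measurable (C n k).
  by apply: measurableI; exact: rings_within_meas.
apply: (@negligible_of_small _ _ _ P _
  (fun n => \big[setU/set0]_(k < n.+1) C n k) (M.+1%:R ^+ 2)).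
- by move=> n; apply: bigsetU_measurable => k _.
- move=> n w /= /not_implyP[pw /existsNP[a /existsNP[b]]] /not_implyP[e /contrapT aM].
  (* [k] is the last grid point strictly before the common ring *)
  have ex : exists k : nat, ringt i a w <= h n *+ k.+1.
    by exists n; rewrite -mulr_natr divfK // pnatr_eq0.
  case: (ex_minnP ex) => k kle kmin.
  have kn : (k < n.+1)%N.
    by rewrite ltnS; apply: kmin; rewrite -mulr_natr divfK // pnatr_eq0.
  have klt : h n *+ k < ringt i a w.
    case: k kle kmin kn => [|k] _ kmin _; first by rewrite mulr0n ringt_gt0.
    by rewrite ltNge; apply/negP => /kmin; rewrite ltnn.
  rewrite -bigcup_mkord; exists k => //; split.
    by apply: (rings_within_ex pw (n := a)); rewrite klt -mulrSr.
  by apply: (rings_within_ex pw (n := b)); rewrite -e klt -mulrSr.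
- move=> n; apply: (@le_trans _ _ (\sum_(k < n.+1) P (C n k))%E).
    exact: Boole_inequality.
  apply: (@le_trans _ _ (\sum_(k < n.+1) (h n ^+ 2)%:E)%E).
    apply: lee_sum => k _; apply: rings_two_sites_le => //.
      by rewrite mulrn_wge0 // ltW.
    exact: ltW.
  rewrite sumEFin lee_fin sumr_const card_ord -[leLHS]mulr_natr /h expr_div_n.
  have n0 : n.+1%:R != 0 :> R by rewrite pnatr_eq0.
  by rewrite -mulrA (expr2 n.+1%:R) invfM -[X in _ * X <= _]mulrA mulVf ?mulr1.
Qed.

(** * Independence of the past and the future *)

Hypothesis ae_explored : forall t j, 0 <= t ->
  {ae P, forall w, explored N (rings_at (fun j n => W j n) w) [fset j]%fset t}.
Hypothesis ae_evolves : {ae P, forall w, evolves (fun j n => W j n) U zeta w}.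

Lemma unbounded_ringt w j u : waits_pos w ->
  explored N (rings_at (fun j n => W j n) w) [fset j]%fset u ->
  exists n, u <= ringt j n w.
Proof.
move=> pw /explored_finite /(_ j); rewrite in_fset1 eqxx => /(_ isT)[l lP].
apply: contrapT => /forallNP lt.
pose s := [seq ringt j n w | n <- iota 0 (size l).+1].
have us : uniq s.
  rewrite map_inj_uniq ?iota_uniq // => n m e.
  by case: (ltngtP n m) => // /(ringt_lt j pw); rewrite e ltxx.
suff sl : {subset s <= l}.
  by have := uniq_leq_size us sl; rewrite size_map size_iota ltnn.
move=> _ /mapP[n _ ->]; apply: lP; first by exists n.
by rewrite ringt_gt0 //= ltNge; apply/negP => /(lt n).
Qed.

Definition regular (t : R) (w : T) : Prop :=
  [/\ evolves (fun j n => W j n) U zeta w, waits_pos w,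
      forall i j n m, i != j -> ringt i n w != ringt j m w,
      0 < t -> forall j n, ringt j n w != t &
      forall j,
        explored N (rings_at (fun j n => W j n) w) [fset j]%fset t /\
        exists n, t < ringt j n w].

Lemma ae_regular t : 0 <= t -> {ae P, forall w, regular t w}.
Proof.
move=> t0.
have ae4 : {ae P, forall w, 0 < t -> forall j n, ringt j n w != t}.
  have [tp|tn] := ltP 0 t; last first.
    by apply: filterE.
  have := ae_forall_countable (I := L) (fun j => ae_no_ring_at j tp).
  by apply: filterS => w h _.
have ae5 : {ae P, forall w j,
    explored N (rings_at (fun j n => W j n) w) [fset j]%fset t}.
  by apply: (ae_forall_countable (I := L)) => j; exact: ae_explored.
have ae6 : {ae P, forall w j,
    explored N (rings_at (fun j n => W j n) w) [fset j]%fset (t + 1)}.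
  by apply: (ae_forall_countable (I := L)) => j; apply: ae_explored; rewrite addr_ge0.
have := ae_and (ae_and (ae_and ae_evolves ae_waits_pos) (ae_and ae5 ae6))
  (ae_and ae_no_ties ae4).
apply: filterS => w [[[h1 h2] [h5 h6]] [h3 h4]].
split => // j; split; first exact: h5.
have [n tn] := unbounded_ringt h2 (h6 j); exists n.
by rewrite (lt_le_trans _ tn) // ltrDl.
Qed.

Definition unringed (j : L) (n : nat) : set (L * nat) :=
  [set jn | ~ (jn.1 = j /\ (n <= jn.2)%N)].

Lemma unringed_down_closed j n : down_closed (unringed j n).
Proof. by move=> i m k km Qm [ij nk]; apply: Qm; split => //; exact: leq_trans km. Qed.

(** [E] belongs to the past of [t]: whenever exactly [n] rings of [j] have
    occurred by then, the sources of the later rings of [j] have no influence on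
    [E].  The event [B] may depend on [n], since on the number of rings of [j] so
    far depends which sources are in the future. *)
Definition adapted (t : R) (E : set T) : Prop :=
  measurable E /\ forall j n, exists2 B, known (past (unringed j n)) B &
    {ae P, forall w, first_after j n t w -> (E w <-> B w)}.

Lemma adapted_forall t (I : countType) (E : I -> set T) :
  (forall i, adapted t (E i)) -> adapted t [set w | forall i, E i w].
Proof.
move=> aE; split; first by apply: measurable_forall => i; case: (aE i).
move=> j n.
have ex i : exists B, known (past (unringed j n)) B /\
    {ae P, forall w, first_after j n t w -> (E i w <-> B w)}.
  by case: (aE i) => _ /(_ j n)[B kB BE]; exists B.
have [B BP] := choice ex.
exists [set w | forall i, B i w].
  by apply: (@measurable_forall _ (alg _)) => i; case: (BP i).
have : {ae P, forall w i, first_after j n t w -> (E i w <-> B i w)}.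
  by apply: ae_forall_countable => i; case: (BP i).
apply: filterS => w h fw; split => /= h' i; first exact/(h i fw).
exact/(h i fw)/h'.
Qed.

Lemma adaptedI t E F : adapted t E -> adapted t F -> adapted t (E `&` F).
Proof.
move=> aE aF.
have := @adapted_forall t bool (fun b => if b then E else F).
rewrite (_ : [set _ | _] = E `&` F); first by apply; case.
apply/seteqP; split => w /=; first by move=> h; split; [exact: (h true)|exact: (h false)].
by move=> [Ew Fw] [].
Qed.

Lemma adapted_init t i a : adapted t [set w | zeta 0 w i = a].
Proof.
split; first exact: zeta_meas.
move=> j n; exists [set w | zeta 0 w i = a]; first exact: known_init.
exact: filterE.
Qed.

(** The state at [t] is the replay of an exploration that sees only the first [n]
    rings of [j], the later ones being after [t]; and whether a given list is the
    record of that exploration is known from the sources that it sees. *)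
Lemma adapted_state t i a : 0 <= t -> adapted t [set w | zeta t w i = a].
Proof.
rewrite le_eqVlt => /orP[/eqP <-|t0]; first exact: adapted_init.
split; first by apply: zeta_meas; exact: ltW.
move=> j n; pose Q := unringed j n.
exists [set w | exists l, (forall jn, jn \in l -> Q jn) /\
   (trace N (fun j n => ringt j n w) Q [fset i]%fset t l /\
    replay (fun j n => U j n w) (zeta 0 w) l i = a)].
  apply: (@measurable_exists _ (alg _)) => l.
  apply: (@measurable_conj _ (alg (past Q))) => Ql.
  apply: (@measurableI _ (alg _)); last exact: known_replay.
  by apply: (@known_trace _ _ (fun=> t)) => //; exact: unringed_down_closed.
apply: filterS (ae_regular (ltW t0)) => w [[jumps const] pw nties nt expl] [fb fa].
have Qt i' n' : ~ Q (i', n') -> t <= ringt i' n' w.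
  move=> /contrapT[/= -> nn']; apply: (le_trans (ltW fa)); exact: ringt_le.
have const' : forall j u t, 0 <= u <= t ->
    (forall n, ~ (u < ringt j n w <= t)) -> zeta t w j = zeta u w j.
  move=> j' u t' ut nr; apply: const => // s [n' <-]; exact: nr.
have sound l : trace N (fun j n => ringt j n w) Q [fset i]%fset t l ->
    zeta t w i = replay (fun j n => U j n w) (zeta 0 w) l i.
  by apply: (trace_state (s := fun u => zeta u w)
    (r := fun j n => ringt j n w) jumps const' nties t0 Qt); exact: nt.
split => /= [za|[l [Ql [tl <-]]]]; last exact: sound.
have [l tl] := trace_complete (expl i).1 Qt.
exists l; split; first exact: trace_labels tl.
by split => //; rewrite -sound.
Qed.

(** The response that matters is the one at the first ring after [t]. *)
Definition hits j t h v b : set T :=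
  \bigcup_n (first_after j n t `&`
    ([set w | ringt j n w <= t + h] `&` [set w | U j n w v = b])).
Arguments hits : clear implicits.

Lemma hits_meas j t h v b : measurable (hits j t h v b).
Proof.
apply: bigcup_measurable => n _; apply: measurableI; first exact: first_after_meas.
apply: measurableI; first exact: hit_meas.
by have [] := @U_law j n v b.
Qed.

(** The rate at which [j] rings and receives the response [b], given the past:
    the waiting time that is running at [t] has no memory, and the response that
    will be used has not been looked at. *)
Lemma hits_prob t h E j v b : 0 <= t -> 0 <= h -> adapted t E ->
  P (E `&` hits j t h v b) = (((1 - expR (- h)) * p j v b)%:E * P E)%E.
Proof.
move=> t0 h0 [mE aE].
have c0 : 0 <= 1 - expR (- h) by rewrite subr_ge0 -expR0 ler_expR oppr_le0.
have p0 : 0 <= p j v b.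
  by rewrite -lee_fin; have [_ <-] := @U_law j 0 v b; exact: measure_ge0.
have mU' n : measurable [set w | U j n w v = b] by have [] := @U_law j n v b.
pose D n := first_after j n t.
pose H n := [set w | ringt j n w <= t + h] `&` [set w | U j n w v = b].
have mD n : measurable (D n) by exact: first_after_meas.
have mH n : measurable (H n) by apply: measurableI => //; exact: hit_meas.
rewrite (_ : E `&` _ = \bigcup_n (D n `&` (E `&` H n))); last first.
  apply/seteqP; split => w /=.
    by move=> [Ew [n _ [Dw Hw]]]; exists n.
  by move=> [n _ [Dw [Ew Hw]]]; split => //; exists n.
rewrite (@prob_partition_scale _ _ _ P _ _ (fun=> E) ((1 - expR (- h)) * p j v b)) //.
- congr (_ * _)%E; apply: ae_eq_prob => //.
    by apply: bigcup_measurable => n _; exact: measurableI.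
  apply: filterS (ae_regular t0) => w [_ _ _ _ /(_ j)[_ [n /first_after_ex[m _ fm]]]].
  by split => [[k _ []]|Ew] //; exists m.
- exact: mulr_ge0.
- by move=> n; exact: measurableI.
- exact: trivIset_first_after.
move=> n; have [B kB BE] := aE j n.
have mB : measurable B by exact: known_meas kB.
pose J1 := past (unringed j n) `|` [set Some (inr (j, n))].
pose J2 := past (unringed j n) `|` [set Some (inl (j, n))].
have -> : P (D n `&` E) = P (D n `&` B).
  apply: ae_eq_prob; [exact: measurableI|exact: measurableI|].
  by apply: filterS BE => w h'; split => -[Dw ?]; split => //; exact/(h' Dw).
have -> : P (D n `&` (E `&` H n)) =
    P (D n `&` ((B `&` [set w | U j n w v = b]) `&` [set w | ringt j n w <= t + h])).
  apply: ae_eq_prob.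
  - by apply: measurableI => //; exact: measurableI.
  - apply: measurableI => //; apply: measurableI; last exact: hit_meas.
    exact: measurableI.
  apply: filterS BE => w h'; split.
    by move=> [Dw [/(h' Dw) Bw [Hw Uw]]].
  by move=> [Dw [[/(h' Dw) Ew Uw] Hw]].
rewrite (@ring_prob J1) //; last 3 first.
- by move=> [h1|//]; apply: h1.
- by move=> k kn; left => -[_ /=]; rewrite leqNgt kn.
- apply: (@measurableI _ (alg J1)).
    by apply: joint_sigma_sub kB => l; left.
  by apply: known_response; right.
rewrite setIA (@known_indep J2 [set Some (inr (j, n))]); last 3 first.
- by apply/seteqP; split => // l /= [[h1|->//] h2]; rewrite h2 /= in h1; apply: h1.
- apply: (@measurableI _ (alg J2)); last by apply: joint_sigma_sub kB => l; left.
  apply: known_first_after => k; rewrite leq_eqVlt => /orP[/eqP ->|kn]; [by right|].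
  by left => -[_ /=]; rewrite leqNgt kn.
- exact: known_response.
have [_ ->] := @U_law j n v b.
by rewrite EFinM -muleA; congr (_ * _)%E; rewrite muleC.
Qed.

(** * The evolution equation *)

Hypothesis p_sum : forall j s, \sum_b p j s b = 1.

Definition cylinder t (K : {fset L}) (c : {ffun K -> A} * {ffun K -> A}) : set T :=
  [set w | forall k : K, zeta 0 w (val k) = c.1 k /\ zeta t w (val k) = c.2 k].

Lemma adapted_cylinder t K c : 0 <= t -> adapted t (@cylinder t K c).
Proof.
move=> t0; apply: adapted_forall => k; apply: adaptedI.
  exact: adapted_init.
exact: adapted_state.
Qed.

Lemma cylinder_meas t K c : 0 <= t -> measurable (@cylinder t K c).
Proof.
move=> t0; apply: measurable_forall => k.
by apply: measurableI; exact: zeta_meas.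
Qed.

Definition obs t (F : (L -> A) -> (L -> A) -> R) (w : T) : R :=
  F (zeta 0 w) (zeta t w).

Lemma obs_cylinders t K F : depends_on2 K F -> obs t F =
  fun w => \sum_(c : {ffun K -> A} * {ffun K -> A})
     F (extend c.1) (extend c.2) * \1_(cylinder t c) w.
Proof.
move=> FK; apply/funext => w.
pose c0 := (restr K (zeta 0 w), restr K (zeta t w)).
rewrite (bigD1 c0) //= big1 ?addr0.
  rewrite indicE mem_set ?mulr1; last by move=> k; rewrite !ffunE.
  by apply: FK => j jK; rewrite extend_restr.
move=> c cc0; rewrite indicE memNset ?mulr0 // => ck.
move/eqP: cc0; apply; rewrite /c0 [c]surjective_pairing.
by congr pair; apply/ffunP => k; rewrite ffunE; case: (ck k).
Qed.

Lemma bounded_mfun_obs t K F : 0 <= t -> depends_on2 K F -> bounded_mfun (obs t F).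
Proof.
move=> t0 /(@obs_cylinders t) ->; apply: bounded_mfun_sum => c; apply: bounded_mfunZ.
by apply: bounded_mfun_indic; exact: cylinder_meas.
Qed.

Lemma mean_hits t h K F j v b : 0 <= t -> 0 <= h -> depends_on2 K F ->
  mean P (fun w => obs t F w * \1_(hits j t h v b) w) =
  (1 - expR (- h)) * p j v b * mean P (obs t F).
Proof.
move=> t0 h0 FK; rewrite (obs_cylinders t FK).
have mc c : measurable (@cylinder t K c) by exact: cylinder_meas.
have mh := @hits_meas j t h v b.
rewrite mean_sum; last by move=> c; apply: bounded_mfunZ; exact: bounded_mfun_indic.
rewrite mulr_sumr.
transitivity (mean P (fun w => \sum_(c : {ffun K -> A} * {ffun K -> A})
     F (extend c.1) (extend c.2) * \1_(cylinder t c `&` hits j t h v b) w)).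
  congr mean; apply/funext => w; rewrite mulr_suml; apply: eq_bigr => c _.
  by rewrite indicI mulrA.
rewrite mean_sum; last by move=> c; apply: bounded_mfunZ; apply/bounded_mfun_indic/measurableI.
apply: eq_bigr => c _.
rewrite !meanZ; [|exact: bounded_mfun_indic|by apply/bounded_mfun_indic/measurableI].
rewrite mulrCA; congr (_ * _).
apply: EFin_inj; rewrite EFinM !mean_indic //; last exact: measurableI.
by apply: hits_prob => //; exact: adapted_cylinder.
Qed.

(** Two rings in [K] between [t] and [t + h], of one site or of two.  The first
    ring after [t] starts a new waiting time, so that the second one costs another
    factor [h]. *)
Definition crowded (K : {fset L}) t h : set T :=
  \big[setU/set0]_(ij <- [seq (i, j) | i <- K, j <- K])
    (if ij.1 == ij.2 then rings_twice ij.1 t h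
     else rings_within ij.1 t h `&` rings_within ij.2 t h).

Let crowded_term ij t h := if ij.1 == ij.2 :> L then rings_twice ij.1 t h
     else rings_within ij.1 t h `&` rings_within ij.2 t h.

Let crowded_term_meas ij t h : measurable (crowded_term ij t h).
Proof.
rewrite /crowded_term; case: ifP => _; first exact: rings_twice_meas.
by apply: measurableI; exact: rings_within_meas.
Qed.

Lemma crowded_meas K t h : measurable (crowded K t h).
Proof.
rewrite /crowded; elim: [seq _ | _ <- _, _ <- _] => [|ij s IH].
  by rewrite big_nil.
by rewrite big_cons; apply: measurableU => //; exact: crowded_term_meas.
Qed.

Lemma crowded_le K t h : 0 <= t -> 0 <= h ->
  (P (crowded K t h) <= (h ^+ 2 *+ size [seq (i, j) | i <- K, j <- K])%:E)%E.
Proof.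
move=> t0 h0; rewrite /crowded; elim: [seq _ | _ <- _, _ <- _] => [|ij s IH].
  by rewrite big_nil measure0.
rewrite big_cons /= mulrS EFinD.
have ms : measurable (\big[setU/set0]_(ij <- s) crowded_term ij t h).
  by elim: s {IH} => [|? ? ?]; rewrite ?big_nil ?big_cons //; apply: measurableU.
apply: le_trans (measureU2 _ (crowded_term_meas ij t h) ms) _.
apply: leeD => //.
have : (P (crowded_term ij t h) <= (h ^+ 2)%:E)%E; last by [].
rewrite /crowded_term; case: eqP => [_|/eqP ij12].
  exact: rings_twice_le.
exact: rings_two_sites_le.
Qed.

Lemma crowded_two K t h i j w : i \in K -> j \in K -> i != j ->
  ~ crowded K t h w -> rings_within i t h w -> ~ rings_within j t h w.
Proof.
move=> iK jK ij ncr ri rj; apply: ncr; rewrite /crowded -bigcup_seq.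
exists (i, j) => /=; first by apply/allpairsP; exists (i, j).
by rewrite (negbTE ij).
Qed.

Lemma crowded_one K t h i w : i \in K -> ~ crowded K t h w -> ~ rings_twice i t h w.
Proof.
move=> iK ncr ri; apply: ncr; rewrite /crowded -bigcup_seq.
exists (i, i) => /=; first by apply/allpairsP; exists (i, i).
by rewrite eqxx.
Qed.

Lemma hits_rings j t h v b w : hits j t h v b w -> rings_within j t h w.
Proof. by move=> [n _ [fn [hn _]]]; exists n. Qed.

(** Unless two rings occur in [K'] during the time [h], at most one site of [K]
    changes, and the neighbourhood that its response sees is still in the state
    it had at time [t]. *)
Lemma one_step_pointwise (K K' : {fset L}) (G : (L -> A) -> R) t h w :
  0 <= t -> 0 <= h -> (K `<=` K')%fset ->
  (forall j, j \in K -> (N j `<=` K')%fset) -> depends_on K G ->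
  regular t w -> ~ crowded K' t h w ->
  G (zeta (t + h) w) - G (zeta t w) =
  \sum_(j <- K) \sum_b \sum_(v : {ffun N j -> A})
    \1_(hits j t h v b) w * ((restr (N j) (zeta t w) == v)%:R *
      (G (set_site (zeta t w) j b) - G (zeta t w))).
Proof.
move=> t0 h0 /fsubsetP KK' NK' GK [[jumps const] pw _ _ _] ncr.
have tth : 0 <= t <= t + h by rewrite t0 lerDl.
have still i : ~ rings_within i t h w -> zeta (t + h) w i = zeta t w i.
  move=> nr; apply: const => // s [n <-] tnh; apply: nr.
  exact: rings_within_ex tnh.
have zero i : ~ rings_within i t h w -> \sum_b \sum_(v : {ffun N i -> A})
    \1_(hits i t h v b) w * ((restr (N i) (zeta t w) == v)%:R *
      (G (set_site (zeta t w) i b) - G (zeta t w))) = 0.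
  move=> nr; apply: big1 => b _; apply: big1 => v _.
  by rewrite indicE memNset ?mul0r // => /hits_rings.
have [[j jK rj]|none] := pselect (exists2 j, j \in K & rings_within j t h w);
  last first.
  rewrite (GK _ (zeta t w)) ?subrr; last first.
    by move=> i iK; apply: still => ri; apply: none; exists i.
  rewrite big_seq big1 // => i iK; apply: zero => ri; apply: none.
  by exists i.
have jK' := KK' _ jK.
have others i : i \in K' -> i != j -> ~ rings_within i t h w.
  by move=> iK' ij; apply: (@crowded_two K' t h j i w) => //; rewrite eq_sym.
have [n _ [[fb fa] /= fh]] := rj.
have after m : (n < m)%N -> ~ (ringt j m w <= t + h).
  move=> nm mh; apply: (crowded_one jK' ncr); exists n => //; split => //; split => //=.
  have := le_trans (ringt_le j pw nm) mh; rewrite ringtS => le.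
  by move: fa le; lra.
have jval : zeta (t + h) w j = U j n w (restr (N j) (zeta t w)).
  transitivity (zeta (ringt j n w) w j).
    apply: const; first by rewrite fh andbT (le_trans t0) // ltW.
    move=> _ [m <-] /andP[h1 h2]; apply: (after m) => //.
    by rewrite ltnNge; apply/negP => /(ringt_le j pw); rewrite leNgt h1.
  apply: (@jump_value _ _ _ _ _ (fun u => zeta u w) (fun j n => ringt j n w)
    (fun j n => U j n w) jumps _ j n t) => //.
  - by move=> i u u' uu' nr; apply: const => // s [m <-]; exact: nr.
  - by rewrite t0.
  - move=> i m iN /andP[h1 h2]; have [ij|ij] := eqVneq i j.
      move: h1 h2; rewrite ij => h1 h2.
      have : (m < n)%N.
        by rewrite ltnNge; apply/negP => /(ringt_le j pw); rewrite leNgt h2.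
      by move=> /fb; rewrite leNgt h1.
    apply: (others i) => //; first exact: (fsubsetP (NK' j jK)).
    by apply: (@rings_within_ex w i m) => //; rewrite h1 /= (le_trans (ltW h2)).
rewrite (bigD1_seq j) ?fset_uniq //= [X in _ = _ + X]big_seq_cond
  [X in _ = _ + X]big1.
  rewrite addr0 (bigD1 (U j n w (restr (N j) (zeta t w)))) //=.
  rewrite [X in _ = _ + X]big1 ?addr0.
    rewrite (bigD1 (restr (N j) (zeta t w))) //= [X in _ = _ + X]big1 ?addr0.
      rewrite eqxx mul1r indicE mem_set ?mul1r.
        congr (_ - _); apply: GK => i iK; rewrite /set_site.
        by case: eqP => [->|/eqP ij] //; apply: still; apply: others => //; exact: KK'.
      by exists n => //; split.
    by move=> v; rewrite eq_sym => /negbTE ->; rewrite mul0r mulr0.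
  move=> b bU; apply: big1 => v _.
  have [vE|] := eqVneq (restr (N j) (zeta t w)) v; last by rewrite mul0r mulr0.
  rewrite indicE memNset ?mul0r // => -[m _ [fm [_ Um]]].
  have mn : m = n.
    apply: (@trivIset_first_after j t m n) => //.
    by exists w; split => //; split.
  by case/eqP: bU; rewrite -Um /= mn vE.
by move=> i /andP[iK ij]; apply: zero; apply: others => //; exact: KK'.
Qed.

Lemma update_mean_depends_on (K K' : {fset L}) (G : (L -> A) -> R) j :
  (K `<=` K')%fset -> (N j `<=` K')%fset -> depends_on K G ->
  depends_on K' (update_mean p j G).
Proof.
move=> /fsubsetP KK' /fsubsetP NK' GK s s' ss'; rewrite /update_mean.
have -> : restr (N j) s = restr (N j) s'.
  by apply/ffunP => i; rewrite !ffunE; apply: ss'; apply: NK'; exact: valP.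
apply: eq_bigr => b _; congr (_ * _); apply: GK => i /KK' iK.
by rewrite /set_site; case: eqP => // _; exact: ss'.
Qed.

(** Forward evolution equation.  The error is quadratic in [h] with a constant
    that does not depend on [t]; this replaces differentiability. *)
Lemma one_step (K0 K : {fset L}) (f G : (L -> A) -> R) :
  depends_on K0 f -> depends_on K G ->
  exists2 C : R, 0 <= C & forall t h, 0 <= t -> 0 <= h ->
    `|mean P (fun w => f (zeta 0 w) * G (zeta (t + h) w)) -
      mean P (fun w => f (zeta 0 w) * G (zeta t w)) -
      h * \sum_(j <- K) (mean P (fun w => f (zeta 0 w) * update_mean p j G (zeta t w)) -
                         mean P (fun w => f (zeta 0 w) * G (zeta t w)))|
    <= C * h ^+ 2.
Proof.
move=> fK GK.
pose K1 := (K `|` \bigcup_(j <- K) N j)%fset.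
pose K2 := (K0 `|` K1)%fset.
have KK1 : (K `<=` K1)%fset by exact: fsubsetUl.
have NK1 j : j \in K -> (N j `<=` K1)%fset.
  by move=> jK; apply: fsubset_trans (fsubsetUr _ _); exact: bigfcup_sup.
have K12 : (K1 `<=` K2)%fset by exact: fsubsetUr.
have f2 : depends_on K2 f by apply: depends_onW fK; exact: fsubsetUl.
have G2 : depends_on K2 G by apply: depends_onW GK; exact: fsubset_trans K12.
have N2 j : j \in K -> (N j `<=` K2)%fset.
  by move=> /NK1 h; exact: fsubset_trans K12.
have [Mf fM] := local_bounded fK; have [MG GM] := local_bounded GK.
have Mf0 : 0 <= Mf by exact: le_trans (normr_ge0 _) (fM (fun=> \bot%O)).
have MG0 : 0 <= MG by exact: le_trans (normr_ge0 _) (GM (fun=> \bot%O)).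
(* what one ring of [j] with response [b] to the neighbourhood state [v] adds *)
pose F j b (v : {ffun N j -> A}) (s u : L -> A) : R :=
  f s * ((restr (N j) u == v)%:R * (G (set_site u j b) - G u)).
have F2 j b v : j \in K -> depends_on2 K2 (@F j b v).
  move=> jK s s' u u' ss' uu'; rewrite /F (f2 _ _ ss') (G2 _ _ uu').
  have -> : restr (N j) u = restr (N j) u'.
    apply/ffunP => i; rewrite !ffunE; apply: uu'.
    by apply: (fsubsetP (N2 _ jK)); exact: valP.
  have -> // : G (set_site u j b) = G (set_site u' j b).
  by apply: G2 => i iK; rewrite /set_site; case: eqP => // _; exact: uu'.
have fG2 : depends_on2 K2 (fun s u => f s * G u).
  by move=> s s' u u' ss' uu'; rewrite (f2 _ _ ss') (G2 _ _ uu').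
have fE2 j : j \in K -> depends_on2 K2 (fun s u => f s * update_mean p j G u).
  move=> jK s s' u u' ss' uu'; rewrite (f2 _ _ ss').
  rewrite (@update_mean_depends_on K K2 G j _ _ GK _ _ uu') //.
    exact: fsubset_trans K12.
  exact: N2.
pose D t j := mean P (fun w => f (zeta 0 w) * update_mean p j G (zeta t w)) -
              mean P (fun w => f (zeta 0 w) * G (zeta t w)).
have sumF t j : 0 <= t -> j \in K ->
    \sum_b \sum_v p j v b * mean P (obs t (@F j b v)) = D t j.
  move=> t0 jK.
  rewrite /D -meanB; [|exact: (bounded_mfun_obs t0 (fE2 _ jK))|exact: (bounded_mfun_obs t0 fG2)].
  transitivity (\sum_b mean P (fun w => \sum_v p j v b * obs t (@F j b v) w)).
    apply: eq_bigr => b _; rewrite mean_sum; last first.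
      by move=> v; apply: bounded_mfunZ; exact: (bounded_mfun_obs t0 (F2 _ _ _ jK)).
    by apply: eq_bigr => v _; rewrite meanZ //; exact: (bounded_mfun_obs t0 (F2 _ _ _ jK)).
  rewrite -mean_sum; last first.
    move=> b; apply: bounded_mfun_sum => v; apply: bounded_mfunZ; exact: (bounded_mfun_obs t0 (F2 _ _ _ jK)).
  congr mean; apply/funext => w; rewrite -mulrBr /update_mean.
  pose v0 := restr (N j) (zeta t w).
  transitivity (\sum_b f (zeta 0 w) *
      (p j v0 b * (G (set_site (zeta t w) j b) - G (zeta t w)))).
    apply: eq_bigr => b _; rewrite (bigD1 v0) //= /obs /F big1 ?addr0.
      by rewrite eqxx mul1r mulrCA.
    by move=> v; rewrite eq_sym => /negbTE ->; rewrite mul0r !mulr0.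
  rewrite -mulr_sumr; congr (_ * _); under eq_bigr do rewrite mulrBr.
  rewrite sumrB -mulr_suml; congr (_ - _).
  by rewrite (@p_sum j v0) mul1r.
pose M := Mf * (MG + MG).
have M0 : 0 <= M by rewrite mulr_ge0 // addr_ge0.
have FM t j b v w : `|obs t (@F j b v) w| <= M.
  rewrite /obs /F normrM ler_pM // normrM.
  apply: le_trans (_ : 1 * (MG + MG) <= _); last by rewrite mul1r.
  rewrite ler_pM //; first by case: (_ == _); rewrite ?normr1 ?normr0.
  by apply: le_trans (ler_normB _ _) _; exact: lerD.
pose M1 := M + \sum_(j : K) \sum_(b : A) \sum_(v : {ffun N (val j) -> A}) M.
have M10 : 0 <= M1.
  by rewrite addr_ge0 // sumr_ge0 // => j _; rewrite sumr_ge0 // => b _;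
     rewrite sumr_ge0.
pose M2 := \sum_(j : K) \sum_b \sum_v `|p (val j) v b| * M.
have M20 : 0 <= M2.
  by rewrite sumr_ge0 // => j _; rewrite sumr_ge0 // => b _;
     rewrite sumr_ge0 // => v _; rewrite mulr_ge0.
pose S := size [seq (i, j) | i <- K2, j <- K2].
exists (M1 *+ S + M2); first by rewrite addr_ge0 // mulrn_wge0.
move=> t h t0 h0.
have th0 : 0 <= t + h by rewrite addr_ge0.
pose Z j b v w := obs t (@F j b v) w * \1_(hits j t h v b) w.
have bZ (j : K) b v : bounded_mfun (Z (val j) b v).
  apply: bounded_mfunM; first exact: (bounded_mfun_obs t0 (F2 _ _ _ (valP j))).
  by apply: bounded_mfun_indic; exact: hits_meas.
pose Y w := f (zeta 0 w) * G (zeta (t + h) w) - f (zeta 0 w) * G (zeta t w) -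
  \sum_(j : K) \sum_b \sum_v Z (val j) b v w.
have bY0 : bounded_mfun (fun w => f (zeta 0 w) * G (zeta (t + h) w) -
                         f (zeta 0 w) * G (zeta t w)).
  by apply: bounded_mfunB; [exact: (bounded_mfun_obs th0 fG2)|exact: (bounded_mfun_obs t0 fG2)].
have bYs : bounded_mfun (fun w => \sum_(j : K) \sum_b \sum_v Z (val j) b v w).
  by do 3!apply: bounded_mfun_sum => ?; exact: bZ.
have bY : bounded_mfun Y by exact: bounded_mfunB.
have YM w : `|Y w| <= M1.
  apply: le_trans (ler_normB _ _) _; apply: lerD.
    rewrite -mulrBr normrM ler_pM //.
    by apply: le_trans (ler_normB _ _) _; exact: lerD.
  do 3!(apply: le_trans (ler_norm_sum _ _ _) _; apply: ler_sum => ? _).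
  rewrite normrM -[leRHS]mulr1 ler_pM //.
  by rewrite indicE; case: (_ \in _); rewrite ?normr1 ?normr0.
have Y0 : {ae P, forall w, ~ crowded K2 t h w -> Y w = 0}.
  apply: filterS (ae_regular t0) => w rw ncr; rewrite /Y -mulrBr.
  rewrite (one_step_pointwise t0 h0 (fsubset_trans KK1 K12) N2 GK rw ncr).
  apply/eqP; rewrite subr_eq0; apply/eqP.
  rewrite big_seq_fsetE /= mulr_sumr; apply: eq_bigr => j _.
  rewrite mulr_sumr; apply: eq_bigr => b _.
  rewrite mulr_sumr; apply: eq_bigr => v _.
  by rewrite /Z /obs /F mulrCA mulrC.
have := norm_mean_small bY (crowded_meas K2 t h) M10 YM Y0 (crowded_le K2 t0 h0).
have -> : mean P Y = mean P (fun w => f (zeta 0 w) * G (zeta (t + h) w)) -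
      mean P (fun w => f (zeta 0 w) * G (zeta t w)) -
      (1 - expR (- h)) * \sum_(j <- K) D t j.
  rewrite /Y meanB // meanB; [|exact: (bounded_mfun_obs th0 fG2)|exact: (bounded_mfun_obs t0 fG2)].
  congr (_ - _); rewrite big_seq_fsetE mulr_sumr mean_sum; last first.
    by move=> j; do 2!apply: bounded_mfun_sum => ?; exact: bZ.
  apply: eq_bigr => j _; rewrite -(sumF t (val j) t0 (valP j)) mulr_sumr mean_sum;
    last by move=> b; apply: bounded_mfun_sum => ?; exact: bZ.
  apply: eq_bigr => b _; rewrite mulr_sumr mean_sum; last by move=> ?; exact: bZ.
  apply: eq_bigr => v _.
  by rewrite /Z (@mean_hits t h K2 _ (val j) v b t0 h0 (F2 _ b v (valP j))) mulrA.
have DM : `|\sum_(j <- K) D t j| <= M2.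
  rewrite big_seq_fsetE; apply: le_trans (ler_norm_sum _ _ _) _.
  apply: ler_sum => j _; rewrite -(sumF t (val j) t0 (valP j)).
  do 2!(apply: le_trans (ler_norm_sum _ _ _) _; apply: ler_sum => ? _).
  rewrite normrM ler_wpM2l //; apply: norm_mean_le => //.
  exact: (bounded_mfun_obs t0 (F2 _ _ _ (valP j))).
have /andP[e1 e2] := one_sub_expRN_bound h0.
rewrite -/S -/(D t).
set X := mean P _ - mean P _; set DD := \sum_(j <- K) D t j in DM *.
move=> le.
have -> : X - h * DD = (X - (1 - expR (- h)) * DD) - (h - (1 - expR (- h))) * DD.
  by ring.
apply: le_trans (ler_normB _ _) _; rewrite [leRHS]mulrDl; apply: lerD.
  by apply: le_trans le _; rewrite mulrnAr mulrnAl.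
rewrite normrM mulrC ler_pM // ger0_norm; lra.
Qed.

End Process.

(** * Comparison for infinite linear systems *)

Section Comparison.
Context {R : realType}.

Lemma le0_of_small (x C : R) (n0 : nat) :
  (forall n, (n0 <= n)%N -> x <= C / n.+1%:R) -> x <= 0.
Proof.
move=> h; rewrite leNgt; apply/negP => x0.
pose n := maxn n0 (Num.bound (C / x)).
have := h n (leq_maxl _ _); rewrite ler_pdivlMr // mulrC -ler_pdivlMr // leNgt.
have [C0|C0] := leP 0 (C / x); last by rewrite (lt_trans C0) // ltr0n.
rewrite (lt_le_trans (archi_boundP C0)) // ler_nat.
by rewrite (leq_trans (leq_maxr n0 _)).
Qed.

Lemma le0_of_geometric (x B r : R) : 0 <= r < 1 ->
  (forall n, x <= B * r ^+ n) -> x <= 0.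
Proof.
move=> /andP[r0 r1] h.
have cv : B * r ^+ n @[n --> \oo] --> B * 0.
  by apply: cvgMr; apply: cvg_expr; rewrite ger0_norm.
rewrite mulr0 in cv.
rewrite -(cvg_lim (@Rhausdorff R) cv).
apply: limr_ge; first by apply/cvg_ex; exists 0.
by near=> n; exact: h.
Unshelve. all: by end_near. Qed.

Lemma expRN_le_quadratic (q : R) : 0 <= q -> expR (- q) <= 1 - q + q ^+ 2.
Proof. by move=> q0; have /andP[h _] := one_sub_expRN_bound q0; lra. Qed.

Variables (I : Type) (u : I -> R -> R) (k : I -> nat) (a b : I -> R)
  (U0 lam c : R).
Hypothesis lam0 : 0 < lam.
Hypothesis lamc : lam <= c.
Hypothesis u0E : forall i t, k i = 0%N -> u i t = 0.
Hypothesis uU0 : forall i t, 0 <= t -> `|u i t| <= U0.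
Hypothesis b0 : forall i, 0 <= b i.
Hypothesis lower : forall i, (k i)%:R * lam + b i <= a i.
Hypothesis upper : forall i, a i <= (k i)%:R * c.
Hypothesis step : forall i, exists2 C : R, 0 <= C &
  forall t h V, 0 <= t -> 0 <= h -> (forall i', `|u i' t| <= V) ->
    `|u i (t + h)| <= `|1 - h * a i| * `|u i t| + h * b i * V + C * h ^+ 2.

Let c0 : 0 < c. Proof. exact: lt_le_trans lamc. Qed.

Let U00 (i : I) : 0 <= U0.
Proof. exact: le_trans (normr_ge0 _) (uU0 i (lexx 0)). Qed.

(** A bound [S e^(-lam t)] that holds for all [u i] up to time [t1] improves by a
    factor that does not depend on [i].  The function
    [z = S e^(-lam t) - (S - U0) (lam / c) e^(-(lam + c) t)] is a supersolution of
    each of the differential inequalities that [step] discretizes: for [k i = 1]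
    because [a i <= c], and for [k i >= 2] because the surplus
    [(k i - 1) lam] of decay makes up for the larger [a i]. *)
Lemma decay_improve (t1 S : R) : 0 <= t1 -> U0 <= S ->
  (forall i t, 0 <= t <= t1 -> `|u i t| <= S * expR (- lam * t)) ->
  forall i t, 0 <= t <= t1 ->
    `|u i t| <= (U0 + (S - U0) * (1 - lam / c * expR (- c * t1))) *
                expR (- lam * t).
Proof.
move=> t10 U0S uS i t /andP[t0 tt1].
pose dl := lam / c.
have dl0 : 0 <= dl by rewrite divr_ge0 // ltW.
have dl1 : dl <= 1 by rewrite ler_pdivrMr // mul1r.
have dlc : dl * c = lam by rewrite divfK // gt_eqF.
have SU0 : 0 <= S - U0 by rewrite subr_ge0.
pose z s := S * expR (- lam * s) - (S - U0) * dl * (expR (- lam * s) * expR (- c * s)).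
have zle : z t <= (U0 + (S - U0) * (1 - dl * expR (- c * t1))) * expR (- lam * t).
  rewrite /z -subr_ge0.
  have -> : (U0 + (S - U0) * (1 - dl * expR (- c * t1))) * expR (- lam * t) -
    (S * expR (- lam * t) - (S - U0) * dl * (expR (- lam * t) * expR (- c * t))) =
    (S - U0) * dl * expR (- lam * t) * (expR (- c * t) - expR (- c * t1)) by ring.
  apply: mulr_ge0; first by rewrite mulr_ge0 ?expR_ge0 // mulr_ge0.
  by rewrite subr_ge0 ler_expR !mulNr lerN2 ler_pM2l.
apply: le_trans zle; rewrite -subr_le0.
have [k0|kpos] := posnP (k i).
  rewrite u0E // normr0 sub0r oppr_le0 /z.
  have e1 := expR_gt0 (- lam * t).
  have e2 : expR (- c * t) <= 1.
    by rewrite -expR0 ler_expR mulNr oppr_le0 mulr_ge0 // ltW.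
  have e20 := expR_ge0 (- c * t).
  rewrite (_ : _ - _ = expR (- lam * t) * (S - (S - U0) * (dl * expR (- c * t))));
    last by ring.
  apply: mulr_ge0; first exact: ltW.
  have : dl * expR (- c * t) <= 1 by rewrite mulr_ile1.
  have dle : 0 <= dl * expR (- c * t) by rewrite mulr_ge0.
  have := U00 i; nra.
have [C C0 CP] := step i.
pose C' := (S - U0) * dl * (lam + c) ^+ 2.
have C'0 : 0 <= C' by rewrite mulr_ge0 ?sqr_ge0 // mulr_ge0.
have k1 : 1 <= (k i)%:R :> R by rewrite ler1n.
have ai0 : 0 <= a i.
  by apply: le_trans (lower i); rewrite addr_ge0 // mulr_ge0 // ltW.
(* the error of one time step is quadratic in [h], since [z] is a supersolution *)
have dstep s h : 0 <= s -> 0 <= h -> s + h <= t1 -> h * a i <= 1 ->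
    `|u i (s + h)| - z (s + h) <=
    (1 - h * a i) * (`|u i s| - z s) + (C + C') * h ^+ 2.
  move=> s0 h0 sh ha.
  have ss : 0 <= s <= t1 by rewrite s0 (le_trans _ sh) // lerDl.
  have := CP s h (S * expR (- lam * s)) s0 h0 (fun i' => uS i' s ss).
  rewrite (ger0_norm (_ : 0 <= 1 - h * a i)) ?subr_ge0 // => le1.
  set E1 := S * expR (- lam * s) in le1 *.
  set D1 := (S - U0) * dl * (expR (- lam * s) * expR (- c * s)).
  have D10 : 0 <= D1 by do !apply: mulr_ge0 => //; exact: expR_ge0.
  have e2 : expR (- c * s) <= 1.
    by rewrite -expR0 ler_expR mulNr oppr_le0 mulr_ge0 // ltW.
  have D1E : D1 <= dl * E1.
    rewrite /D1 /E1 (_ : dl * _ = S * dl * (expR (- lam * s) * 1)); last by ring.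
    apply: ler_pM.
    - exact: mulr_ge0.
    - by apply: mulr_ge0; exact: expR_ge0.
    - by rewrite ler_wpM2r // lerBlDr lerDl (U00 i).
    - by rewrite ler_wpM2l // expR_ge0.
  have D1C : D1 * (lam + c) ^+ 2 <= C'.
    have e1 : expR (- lam * s) <= 1.
      by rewrite -expR0 ler_expR mulNr oppr_le0 mulr_ge0 // ltW.
    rewrite /C' ler_wpM2r ?sqr_ge0 // /D1 -[leRHS]mulr1.
    apply: ler_wpM2l; first exact: mulr_ge0.
    by apply: mulr_ile1 => //; exact: expR_ge0.
  have E10 : 0 <= E1 by rewrite mulr_ge0 ?expR_ge0 // (le_trans (U00 i)).
  have zs : z s = E1 - D1 by [].
  have zsh : (1 - lam * h) * E1 - D1 * (1 - (lam + c) * h + ((lam + c) * h) ^+ 2)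
      <= z (s + h).
    rewrite /z (_ : S * _ = E1 * expR (- (lam * h))); last first.
      by rewrite /E1 -mulrA -expRD; congr (_ * expR _); ring.
    rewrite (_ : (S - U0) * dl * _ = D1 * expR (- ((lam + c) * h))); last first.
      by rewrite /D1 -[RHS]mulrA -!expRD; congr (_ * expR _); ring.
    apply: lerB.
      by rewrite mulrC ler_wpM2l //; have := expR_ge1Dx (- (lam * h)); lra.
    rewrite ler_wpM2l //; apply: expRN_le_quadratic.
    by rewrite mulr_ge0 // addr_ge0 // ltW.
  have key : D1 * (a i - lam - c) <= E1 * (a i - lam - b i).
    apply: (@le_trans _ _ (D1 * (((k i)%:R - 1) * c))).
      rewrite ler_wpM2l // mulrBl mul1r lerB // lerBlDr.
      by rewrite (le_trans (upper i)) // lerDl ltW.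
    apply: (@le_trans _ _ (dl * E1 * (((k i)%:R - 1) * c))).
      by rewrite ler_wpM2r // mulr_ge0 ?subr_ge0 // ltW.
    rewrite (_ : _ * _ = E1 * (((k i)%:R - 1) * (dl * c))); last by ring.
    rewrite dlc ler_wpM2l // mulrBl mul1r lerBrDr lerBrDr.
    by rewrite addrAC subrK; exact: lower.
  have keyh : h * (D1 * (a i - lam - c)) <= h * (E1 * (a i - lam - b i)).
    by rewrite ler_wpM2l.
  have D1Ch : D1 * (lam + c) ^+ 2 * h ^+ 2 <= C' * h ^+ 2.
    by rewrite ler_wpM2r // sqr_ge0.
  rewrite zs; move: le1 zsh keyh D1Ch; rewrite exprMn; clear.
  move: (`|u i (s + h)|) (`|u i s|) (z (s + h)) => ush us zsh.
  move=> h1 h2 h3 h4.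
  have e : (1 - h * a i) * (us - (E1 - D1)) + (C + C') * h ^+ 2 =
    ((1 - h * a i) * us + h * b i * E1 + C * h ^+ 2) -
    ((1 - lam * h) * E1 - D1 * (1 - (lam + c) * h + (lam + c) ^+ 2 * h ^+ 2)) +
    (h * (E1 * (a i - lam - b i)) - h * (D1 * (a i - lam - c))) +
    (C' * h ^+ 2 - D1 * (lam + c) ^+ 2 * h ^+ 2) by ring.
  rewrite e; lra.
apply: (@le0_of_small _ ((C + C') * t ^+ 2) (Num.bound (t * a i))) => n nb.
pose h := t / n.+1%:R.
have h0 : 0 <= h by rewrite divr_ge0.
have nh : h * n.+1%:R = t by rewrite divfK // pnatr_eq0.
have ha : h * a i <= 1.
  rewrite /h mulrAC ler_pdivrMr ?ltr0n // mul1r ltW //.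
  rewrite (lt_le_trans (archi_boundP _)) ?mulr_ge0 // ler_nat.
  by rewrite (leq_trans nb).
have ind m : (m <= n.+1)%N -> `|u i (h * m%:R)| - z (h * m%:R) <=
    m%:R * ((C + C') * h ^+ 2).
  elim: m => [_|m IH mn].
    rewrite mulr0 mul0r /z !mulr0 expR0 !mulr1.
    have := uU0 i (lexx 0).
    have : (S - U0) * dl <= (S - U0) * 1 by rewrite ler_wpM2l.
    by rewrite mulr1; lra.
  rewrite -[in X in X <= _]natr1 [h * _]mulrDr mulr1.
  apply: le_trans (dstep _ _ _ _ _ _) _ => //.
  - by rewrite mulr_ge0.
  - by rewrite -{2}[h]mulr1 -mulrDr natr1 (le_trans _ tt1) // -nh ler_wpM2l // ler_nat.
  rewrite -[X in _ <= X * _]natr1 [leRHS]mulrDl mul1r lerD2r.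
  have {}IH := IH (ltnW mn).
  have q0 : 0 <= m%:R * ((C + C') * h ^+ 2).
    by do !apply: mulr_ge0 => //; exact: addr_ge0.
  have [d0|d0] := leP (`|u i (h * m%:R)| - z (h * m%:R)) 0.
    apply: le_trans q0; apply: mulr_ge0_le0 => //; by rewrite subr_ge0.
  apply: le_trans IH; rewrite ler_piMl ?(ltW d0) // gerBl mulr_ge0 //.
have := ind n.+1 (leqnn _); rewrite nh => /le_trans; apply.
have fe (q : R) : q != 0 ->
    q * ((C + C') * (t / q) ^+ 2) = (C + C') * t ^+ 2 / q by move=> q0; field.
by rewrite /h fe // pnatr_eq0.
Qed.

(** Iterating the improvement brings [S] down to [U0]; the initial [S] is finite
    because the [u i] are bounded uniformly in [i]. *)
Lemma uniform_exponential_bound i t : 0 <= t -> `|u i t| <= U0 * expR (- lam * t).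
Proof.
move=> t0; pose S0 := U0 * expR (lam * t).
pose r := 1 - lam / c * expR (- c * t).
have r01 : 0 <= r < 1.
  have e1 := expR_gt0 (- c * t).
  have e2 : expR (- c * t) <= 1.
    by rewrite -expR0 ler_expR mulNr oppr_le0 mulr_ge0 // ltW.
  have d0 : 0 < lam / c by rewrite divr_gt0.
  have d1 : lam / c <= 1 by rewrite ler_pdivrMr // mul1r.
  apply/andP; split; rewrite /r; last by rewrite gtrBl mulr_gt0.
  by rewrite subr_ge0 mulr_ile1 // ltW.
have S0U0 : 0 <= S0 - U0.
  by rewrite subr_ge0 ler_peMr ?(U00 i) // -expR0 ler_expR mulr_ge0 // ltW.
have H n i' s : 0 <= s <= t ->
    `|u i' s| <= (U0 + (S0 - U0) * r ^+ n) * expR (- lam * s).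
  elim: n i' s => [|n IH] i' s st.
    rewrite expr0 mulr1 addrC subrK /S0 -mulrA -expRD.
    have /andP[s0 st'] := st.
    apply: le_trans (uU0 i' s0) _; rewrite ler_peMr ?(U00 i) // -expR0 ler_expR.
    by rewrite mulNr -mulrBr mulr_ge0 ?subr_ge0 // ltW.
  have := @decay_improve t (U0 + (S0 - U0) * r ^+ n) t0 _ IH i' s st.
  rewrite [_ + _ - U0]addrAC subrr add0r -/r -mulrA -exprSr; apply.
  by rewrite lerDl mulr_ge0 // exprn_ge0 //; case/andP: r01.
have tt : 0 <= t <= t by rewrite t0 lexx.
rewrite -ler_pdivrMr ?expR_gt0 // -subr_le0.
apply: (le0_of_geometric r01 (B := S0 - U0)) => n.
rewrite lerBlDl ler_pdivrMr ?expR_gt0 //.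
exact: H.
Qed.

End Comparison.

(** * Products of basis functions *)

Section ProductBasis.
Context {R : realType} {dA : Order.disp_t} {A : finTBOrderType dA} {L : countType}
  (x y : nonmin A -> R).
Local Notation nonmin := (nonmin A).
Local Notation pindex := (pindex A L).
Implicit Types (m : pindex) (s : L -> A).

Lemma chi_fnd m s :
  chi x y m s = \prod_(j <- domf m) oapp (fun a => chi1 x y j a s) 1 m.[? j]%fmap.
Proof.
rewrite big_seq_fsetE; apply: eq_bigr => j _.
by rewrite -Some_fnd.
Qed.

Lemma chi_nil s : chi x y ([fmap]%fmap : pindex) s = 1.
Proof. by rewrite chi_fnd big_seq_fset0. Qed.

Lemma chi_set m j a s : j \notin domf m ->
  chi x y m.[j <- a]%fmap s = chi1 x y j a s * chi x y m s.
Proof.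
move=> jm; rewrite chi_fnd.
pose F i := oapp (fun b => chi1 x y i b s) 1 m.[j <- a].[? i]%fmap.
rewrite -/(\prod_(i <- domf m.[j <- a]%fmap) F i).
have -> : \prod_(i <- domf m.[j <- a]%fmap) F i = \prod_(i <- (j |` domf m)%fset) F i.
  by rewrite dom_setf.
rewrite big_fsetU1 //= {1}/F fnd_set eqxx /= chi_fnd.
congr (_ * _); apply: eq_big_seq => i im; rewrite /F fnd_set ifN //.
by apply: contraNneq jm => <-.
Qed.

Lemma chi_pindex1 j a s : chi x y (pindex1 j a) s = chi1 x y j a s.
Proof. by rewrite /pindex1 chi_set ?chi_nil ?mulr1 // in_fset0. Qed.

Lemma fmap_set_rem m j a : m.[? j]%fmap = Some a -> m = (m.[~ j]).[j <- a]%fmap.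
Proof.
move=> ma; apply/fmapP => i; rewrite fnd_set fnd_rem1.
by case: eqP => [->|//].
Qed.

Lemma chi_site m j a s : m.[? j]%fmap = Some a ->
  chi x y m s = chi1 x y j a s * chi x y m.[~ j]%fmap s.
Proof.
by move=> /fmap_set_rem {1}->; rewrite chi_set // mem_remf1 eqxx.
Qed.

Lemma chi_depends_on m : depends_on (domf m) (chi x y m).
Proof.
move=> s s' ss'; rewrite !chi_fnd; apply: eq_big_seq => j jm.
by case: (m.[? j])%fmap => //= a; rewrite /chi1 ss'.
Qed.

Lemma norm_chi_le1 m s : (forall a, `|x a| <= 1 /\ `|y a| <= 1) ->
  `|chi x y m s| <= 1.
Proof.
move=> xy1; rewrite /chi normr_prod; apply: prodr_ile1 => j _.
by rewrite normr_ge0 /chi1 /=; case: ifP => _; case: (xy1 (m j)).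
Qed.

Lemma update_mean_chi (N : L -> {fset L}) (p : transition_family R A N) m j a s :
  m.[? j]%fmap = Some a -> update_mean p j (chi x y m) s =
    update_mean p j (chi x y (pindex1 j a)) s * chi x y m.[~ j]%fmap s.
Proof.
move=> ma; rewrite /update_mean mulr_suml; apply: eq_bigr => b _.
rewrite (chi_site _ ma) chi_pindex1 -mulrA; congr (_ * (_ * _)).
apply: chi_depends_on => i; rewrite mem_remf1 => /andP[ij _].
by rewrite /set_site (negbTE ij).
Qed.

(** The coefficient of the constant counts, unlike in [pi_norm]: only so is the
    set of these functions closed under products. *)
Definition unit_expansion (g : (L -> A) -> R) : Prop :=
  exists2 l : seq (R * pindex), \sum_(rm <- l) `|rm.1| <= 1 &
    forall s, g s = \sum_(rm <- l) rm.1 * chi x y rm.2 s.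

Lemma unit_expansion_chi m : unit_expansion (chi x y m).
Proof.
exists [:: (1, m)]; first by rewrite big_seq1 normr1.
by move=> s; rewrite big_seq1 mul1r.
Qed.

Lemma unit_expansion_mul g f : unit_expansion g ->
  (forall m, unit_expansion (fun s => chi x y m s * f s)) ->
  unit_expansion (fun s => g s * f s).
Proof.
move=> [l l1 gl] hf.
have [l' l'l fl'] : exists2 l' : seq (R * pindex),
    \sum_(rm <- l') `|rm.1| <= \sum_(rm <- l) `|rm.1| &
    forall s, (\sum_(rm <- l) rm.1 * chi x y rm.2 s) * f s =
              \sum_(rm <- l') rm.1 * chi x y rm.2 s.
  elim: l {l1 gl} => [|[r m] l [l' l'l fl']].
    by exists [::] => [|s]; rewrite !big_nil ?mul0r.
  have [k k1 fk] := hf m.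
  exists ([seq (r * rm.1, rm.2) | rm <- k] ++ l').
    rewrite big_cat big_cons /= lerD // big_map.
    under eq_bigr do rewrite /= normrM.
    by rewrite -mulr_sumr ler_piMr.
  move=> s; rewrite big_cat big_cons /= mulrDl fl'; congr (_ + _).
  rewrite big_map -mulrA fk mulr_sumr; apply: eq_bigr => i _ /=.
  by rewrite mulrA.
exists l'; first exact: le_trans l1.
by move=> s; rewrite gl fl'.
Qed.

Hypothesis xy_le1 : forall a, `|x a| <= 1 /\ `|y a| <= 1.
Hypothesis xy_le0 : forall a, x a * y a <= 0.
Hypothesis xy_lt : forall a b : nonmin, (val b < val a)%O ->
  `|x b| + `|y a| + `|x b * y a| <= 1.

Lemma chi1_mul_lt j (a b : nonmin) s : (val b < val a)%O ->
  chi1 x y j a s * chi1 x y j b s =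
  x b * chi1 x y j a s + y a * chi1 x y j b s - x b * y a.
Proof.
move=> ba; rewrite /chi1; case: (boolP (val a <= s j)%O) => [as_|_].
  by rewrite (le_trans (ltW ba) as_); ring.
by case: (val b <= s j)%O; ring.
Qed.

Lemma chi1_sqr j (a : nonmin) s : chi1 x y j a s * chi1 x y j a s =
  (x a + y a) * chi1 x y j a s - x a * y a.
Proof. by rewrite /chi1; case: ifP => _; ring. Qed.

Lemma sqr_coef_le1 a : `|x a + y a| + `|x a * y a| <= 1.
Proof.
have [] := xy_le1 a; have := xy_le0 a.
rewrite !ler_norml => xy0 /andP[h1 h2] /andP[h3 h4].
rewrite (ler0_norm xy0).
have p1 : 0 <= (1 - x a) * (1 - y a) by rewrite mulr_ge0 // subr_ge0.
have p2 : 0 <= (1 + x a) * (1 + y a) by rewrite mulr_ge0 // -lerBlDl sub0r.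
by case: (ger0P (x a + y a)) => _; move: p1 p2; lra.
Qed.

(** If [j] already carries the level [a], then the product at [j] is a
    combination of the factors at the levels [a] and [b] and of 1: for [a <> b]
    the conditions on pairs of levels say that the coefficient sum is at most 1,
    and for [a = b] this follows from the bounds and the opposite signs of [x a]
    and [y a]. *)
Lemma unit_expansion_chi1 m j b :
  unit_expansion (fun s => chi x y m s * chi1 x y j b s).
Proof.
case ma: (m.[? j])%fmap => [a|]; last first.
  exists [:: (1, m.[j <- b]%fmap)]; first by rewrite big_seq1 normr1.
  move=> s; rewrite big_seq1 mul1r chi_set; first exact: mulrC.
  by apply: contraPN ma => jm; rewrite in_fnd.
have jr : j \notin domf m.[~ j]%fmap by rewrite mem_remf1 eqxx.
pose m' c : pindex := (m.[~ j]).[j <- c]%fmap.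
have chiE c s : chi x y (m' c) s = chi1 x y j c s * chi x y m.[~ j]%fmap s.
  by rewrite /m' chi_set.
have gen c1 c2 c3 : `|c1| + `|c2| + `|c3| <= 1 ->
    (forall s, chi1 x y j a s * chi1 x y j b s =
      c1 * chi1 x y j a s + c2 * chi1 x y j b s + c3) ->
    unit_expansion (fun s => chi x y m s * chi1 x y j b s).
  move=> c1c h; exists [:: (c1, m' a); (c2, m' b); (c3, m.[~ j]%fmap)].
    by rewrite !big_cons big_nil /= addr0 addrA.
  move=> s; rewrite !big_cons big_nil /= addr0 !chiE (chi_site s ma).
  by rewrite mulrAC h; ring.
case: (ltgtP (val a) (val b)) => [ab|ba|/val_inj ab].
- apply: (gen (y b) (x a) (- (x a * y b))) => [|s].
    by rewrite normrN [_ + `|x a|]addrC; exact: xy_lt.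
  by rewrite mulrC chi1_mul_lt //; ring.
- apply: (gen (x b) (y a) (- (x b * y a))) => [|s].
    by rewrite normrN; exact: xy_lt.
  by rewrite chi1_mul_lt.
- apply: (gen (x a + y a) 0 (- (x a * y a))) => [|s].
    by rewrite normrN normr0 addr0; exact: sqr_coef_le1.
  by rewrite -ab chi1_sqr mul0r addr0.
Qed.

Lemma unit_expansion_chiM m1 m2 :
  unit_expansion (fun s => chi x y m1 s * chi x y m2 s).
Proof.
have [n] := ubnP #|` domf m2|; elim: n m1 m2 => // n IH m1 m2.
rewrite ltnS => m2n.
have [d0|[j jm]] := fset_0Vmem (domf m2).
  have [l l1 h] := unit_expansion_chi m1; exists l => // s.
  rewrite -h [X in _ * X]chi_fnd big_seq big1 ?mulr1 // => i im.
  by have := im; rewrite {1}d0 in_fset0.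
have m2b : m2.[? j]%fmap = Some (m2.[jm])%fmap by rewrite in_fnd.
have dn : (#|` domf m2.[~ j]%fmap| < n)%N.
  apply: leq_trans m2n; apply: fproper_ltn_card; rewrite fproperE.
  apply/andP; split; first by apply/fsubsetP => i; rewrite mem_remf1 => /andP[].
  by apply/negP => /fsubsetP /(_ _ jm); rewrite mem_remf1 eqxx.
have [l l1 h] := unit_expansion_mul (unit_expansion_chi1 m1 j (m2.[jm])%fmap)
  (fun m => IH m m2.[~ j]%fmap dn).
by exists l => // s; rewrite -h (chi_site s m2b) mulrA.
Qed.

End ProductBasis.

(** * Decay of correlations *)

Section Evolution.
Context {R : realType} {dA : Order.disp_t} {A : finTBOrderType dA}
  {L : countType} {N : L -> {fset L}} {d : measure_display}
  {T : measurableType d} (P : probability T R) (zeta : R -> T -> L -> A)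
  (p : transition_family R A N).

Lemma in_IPS_one_step (K0 K : {fset L}) (f G : (L -> A) -> R) :
  is_transition_matrix p -> causal R N -> in_IPS p P zeta ->
  depends_on K0 f -> depends_on K G ->
  exists2 C : R, 0 <= C & forall t h, 0 <= t -> 0 <= h ->
    `|mean P (fun w => f (zeta 0 w) * G (zeta (t + h) w)) -
      mean P (fun w => f (zeta 0 w) * G (zeta t w)) -
      h * \sum_(j <- K) (mean P (fun w => f (zeta 0 w) * update_mean p j G (zeta t w)) -
                         mean P (fun w => f (zeta 0 w) * G (zeta t w)))|
    <= C * h ^+ 2.
Proof.
move=> ptr cN [zm [W [U [cl ul ind ev]]]] fK GK.
apply: (@one_step _ _ _ _ _ _ _ P zeta W U p zm _ ul ind _ ev _ K0 K f G fK GK).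
- by case: cl.
- by move=> t j t0; apply: cN.
- by move=> j s; case: (ptr j s).
Qed.

Hypothesis zeta_meas : forall t j a, 0 <= t -> measurable [set w | zeta t w j = a].

Lemma bounded_mfun_product (K0 K : {fset L}) (f g : (L -> A) -> R) t : 0 <= t ->
  depends_on K0 f -> depends_on K g ->
  bounded_mfun (fun w => f (zeta 0 w) * g (zeta t w)).
Proof.
move=> t0 fK gK.
apply: (@bounded_mfun_obs _ _ _ _ _ _ zeta zeta_meas t (K0 `|` K)%fset
  (fun s u => f s * g u)) => // s s' u u' ss' uu'.
rewrite (depends_onW (fsubsetUl K0 K) fK ss').
by rewrite (depends_onW (fsubsetUr K0 K) gK uu').
Qed.

Lemma bounded_mfun_state (K : {fset L}) (g : (L -> A) -> R) t : 0 <= t ->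
  depends_on K g -> bounded_mfun (fun w => g (zeta t w)).
Proof.
move=> t0 gK; have := @bounded_mfun_product fset0 K (fun=> 1) g t t0.
rewrite (_ : (fun w => 1 * _) = fun w => g (zeta t w)); first exact.
by apply/funext => w; rewrite mul1r.
Qed.

Lemma expectation_mean (X : T -> R) : bounded_mfun X -> 'E_P[X]%E = (mean P X)%:E.
Proof.
move=> bX; have iX := bounded_mfun_integrable P bX.
rewrite /mean /Rintegral fineK; first by rewrite unlock.
exact: integrable_fin_num.
Qed.

Lemma covariance_centered (X Y : T -> R) : bounded_mfun X -> bounded_mfun Y ->
  covariance P X Y = (mean P (fun w => (X w - mean P X) * Y w))%:E.
Proof.
move=> bX bY; have bXY := bounded_mfunM bX bY.
have bL (Z : T -> R) : bounded_mfun Z -> Z \in Lfun P 1.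
  by move=> bZ; apply/Lfun1_integrable; exact: bounded_mfun_integrable.
rewrite covarianceE; [|exact: bL|exact: bL|exact: bL].
rewrite !expectation_mean // -EFinM -EFinB; congr _%:E.
have -> : (fun w => (X w - mean P X) * Y w) = fun w => X w * Y w - mean P X * Y w.
  by apply/funext => w; rewrite mulrBl.
by rewrite meanB ?meanZ //; exact: bounded_mfunZ.
Qed.

End Evolution.

Section Decay.
Context {R : realType} {dA : Order.disp_t} {A : finTBOrderType dA}
  {L : countType} {N : L -> {fset L}} {d : measure_display}
  {T : measurableType d} (P : probability T R) (zeta : R -> T -> L -> A)
  (p : transition_family R A N) (x y : nonmin A -> R) (lam c : R).
Local Notation pindex := (pindex A L).
Hypothesis jN : forall j, j \in N j.
Hypothesis ptr : is_transition_matrix p.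
Hypothesis cN : causal R N.
Hypothesis xy : forall a, x a != y a.
Hypothesis xy_le1 : forall a, `|x a| <= 1 /\ `|y a| <= 1.
Hypothesis xy_le0 : forall a, x a * y a <= 0.
Hypothesis xy_lt : forall a b : nonmin A, (val b < val a)%O ->
  `|x b| + `|y a| + `|x b * y a| <= 1.
Hypothesis zeta_IPS : in_IPS p P zeta.

Let C j a := update_coef x y p j a.
Let row j a := \sum_(m <- finsupp (C j a) | m != pindex1 j a) `|C j a m|.

Hypothesis lam0 : 0 < lam.
Hypothesis lamc : lam <= c.
Hypothesis diag_le : forall j a, 1 - C j a (pindex1 j a) <= c.
Hypothesis row_le : forall j a, C j a (pindex1 j a) + row j a <= 1 - lam.

Variables (K0 : {fset L}) (f : (L -> A) -> R) (U0 : R).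
Hypothesis fK : depends_on K0 f.
Hypothesis fU0 : forall s, `|f s| <= U0.
Hypothesis f_centered : mean P (fun w => f (zeta 0 w)) = 0.

Let zeta_meas t j a : 0 <= t -> measurable [set w | zeta t w j = a].
Proof. by case: zeta_IPS => h _; exact: h. Qed.

Definition pairing t (g : (L -> A) -> R) : R :=
  mean P (fun w => f (zeta 0 w) * g (zeta t w)).

Let bounded_mfun_chi t m : 0 <= t -> bounded_mfun (fun w => f (zeta 0 w) * chi x y m (zeta t w)).
Proof. by move=> t0; apply: (bounded_mfun_product zeta_meas t0 fK); exact: chi_depends_on. Qed.

Lemma pairing_expansion t (I : Type) (l : seq I) (r : I -> R) (m : I -> pindex) :
  0 <= t -> pairing t (fun s => \sum_(i <- l) r i * chi x y (m i) s) =
  \sum_(i <- l) r i * pairing t (chi x y (m i)).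
Proof.
move=> t0; transitivity (mean P (fun w => \sum_(i <- l)
    r i * (f (zeta 0 w) * chi x y (m i) (zeta t w)))).
  congr mean; apply/funext => w; rewrite mulr_sumr.
  by apply: eq_bigr => i _; rewrite mulrCA.
rewrite mean_sum; last by move=> i; apply: bounded_mfunZ; exact: bounded_mfun_chi.
by apply: eq_bigr => i _; rewrite meanZ //; exact: bounded_mfun_chi.
Qed.

Lemma pairing_unit_expansion t V g : 0 <= t -> unit_expansion x y g ->
  (forall m, `|pairing t (chi x y m)| <= V) -> `|pairing t g| <= V.
Proof.
move=> t0 [l l1 gl] uV.
have V0 : 0 <= V by exact: le_trans (normr_ge0 _) (uV [fmap]%fmap).
have -> : g = fun s => \sum_(rm <- l) rm.1 * chi x y rm.2 s by apply/funext.
rewrite pairing_expansion //; apply: le_trans (ler_norm_sum _ _ _) _.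
apply: (@le_trans _ _ (\sum_(rm <- l) `|rm.1| * V)).
  by apply: ler_sum => rm _; rewrite normrM ler_wpM2l.
by rewrite -mulr_suml ler_piMl.
Qed.

(** The diagonal coefficient at [j], multiplied back by the other factors of
    [chi m], gives a multiple of [chi m] itself; for the remaining terms that
    multiplication does not increase coefficient sums. *)
Lemma pairing_update t V (m : pindex) j a : 0 <= t -> m.[? j]%fmap = Some a ->
  (forall m', `|pairing t (chi x y m')| <= V) ->
  `|pairing t (update_mean p j (chi x y m)) -
    C j a (pindex1 j a) * pairing t (chi x y m)| <= row j a * V.
Proof.
move=> t0 ma uV.
have V0 : 0 <= V by exact: le_trans (normr_ge0 _) (uV [fmap]%fmap).
pose g m' s := chi x y m' s * chi x y m.[~ j]%fmap s.
have gu m' : unit_expansion x y (g m') by exact: unit_expansion_chiM.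
have bg m' : bounded_mfun (fun w => f (zeta 0 w) * g m' (zeta t w)).
  apply: (@bounded_mfun_product _ _ _ _ _ _ zeta zeta_meas K0
    (domf m' `|` domf m.[~ j]%fmap)%fset) => // s s' ss'.
  rewrite /g (depends_onW (fsubsetUl _ _) (chi_depends_on x y (m := m')) ss').
  by rewrite (depends_onW (fsubsetUr _ _) (chi_depends_on x y (m := m.[~ j]%fmap)) ss').
have gm : g (pindex1 j a) = chi x y m.
  by apply/funext => s; rewrite /g chi_pindex1 -chi_site.
have [_ upE] := update_coefP p a xy (jN j).
have -> : pairing t (update_mean p j (chi x y m)) =
    \sum_(m' <- finsupp (C j a)) C j a m' * pairing t (g m').
  transitivity (mean P (fun w => \sum_(m' <- finsupp (C j a))
      C j a m' * (f (zeta 0 w) * g m' (zeta t w)))).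
    congr mean; apply/funext => w; rewrite (update_mean_chi _ _ _ _ ma) upE.
    rewrite mulr_suml mulr_sumr; apply: eq_bigr => m' _.
    by rewrite /g -[X in _ * X = _]mulrA mulrCA.
  rewrite mean_sum; last by move=> m'; exact: bounded_mfunZ.
  by apply: eq_bigr => m' _; rewrite meanZ.
have -> : \sum_(m' <- finsupp (C j a)) C j a m' * pairing t (g m') =
    C j a (pindex1 j a) * pairing t (chi x y m) +
    \sum_(m' <- finsupp (C j a) | m' != pindex1 j a) C j a m' * pairing t (g m').
  have [sup|nsup] := boolP (pindex1 j a \in finsupp (C j a)).
    by rewrite (bigD1_seq _ sup (fset_uniq _)) /= gm.
  rewrite (fsfun_dflt nsup) mul0r add0r [RHS]big_seq_cond [LHS]big_seq.
  apply: eq_bigl => m'; case: (boolP (m' \in _)) => //= m'sup.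
  by rewrite (_ : m' != _) //; apply: contraNneq nsup => <-.
rewrite addrC addKr; apply: le_trans (ler_norm_sum _ _ _) _.
rewrite /row mulr_suml; apply: ler_sum => m' _.
by rewrite normrM ler_wpM2l // pairing_unit_expansion.
Qed.

Lemma pairing_chi_decay (m : pindex) t : 0 <= t ->
  `|pairing t (chi x y m)| <= U0 * expR (- lam * t).
Proof.
move=> t0.
pose a (m : pindex) := \sum_(j : domf m)
  (1 - C (val j) (m j) (pindex1 (val j) (m j))).
pose b (m : pindex) := \sum_(j : domf m) row (val j) (m j).
pose k (m : pindex) := #|` domf m|.
apply: (@uniform_exponential_bound R pindex
  (fun m t => pairing t (chi x y m)) k a b U0 lam c lam0 lamc) => //.
- move=> m' s /eqP; rewrite cardfs_eq0 => /eqP m0.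
  rewrite -[RHS]f_centered /pairing; congr mean; apply/funext => w.
  rewrite chi_fnd big_seq big1 ?mulr1 // => i im.
  by have := im; rewrite {1}m0 in_fset0.
- move=> m' s s0; apply: norm_mean_le; first exact: bounded_mfun_chi.
  move=> w; rewrite normrM -[leRHS]mulr1 ler_pM //.
  exact: norm_chi_le1.
- by move=> m'; apply: sumr_ge0 => j _; apply: sumr_ge0.
- move=> m'; rewrite /k /a /b cardfE -sum1_card natr_sum mulr_suml -big_split /=.
  apply: ler_sum => j _; rewrite mul1r.
  have := row_le (val j) (m' j); lra.
- move=> m'; rewrite /k /a cardfE -sum1_card natr_sum mulr_suml.
  by apply: ler_sum => j _; rewrite mul1r; exact: diag_le.
move=> {}m.
have [D D0 DP] := in_IPS_one_step ptr cN zeta_IPS fK (@chi_depends_on _ _ _ _ x y m).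
exists D => // s h V s0 h0 uV.
have V0 : 0 <= V by exact: le_trans (normr_ge0 _) (uV [fmap]%fmap).
have := DP s h s0 h0; rewrite -/(pairing (s + h) (chi x y m)).
rewrite -/(pairing s (chi x y m)) big_seq_fsetE /=.
set uh := pairing (s + h) _; set us := pairing s (chi x y m) => le.
pose rest (j : domf m) := pairing s (update_mean p (val j) (chi x y m)) -
   C (val j) (m j) (pindex1 (val j) (m j)) * us.
have restV j : `|rest j| <= row (val j) (m j) * V.
  by apply: pairing_update => //; rewrite -Some_fnd.
have sumE : \sum_(j : domf m) (pairing s (update_mean p (val j) (chi x y m)) - us) =
    \sum_j rest j - a m * us.
  rewrite /a mulr_suml -sumrB; apply: eq_bigr => j _.
  by rewrite /rest; ring.
have restS : `|\sum_j rest j| <= b m * V.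
  apply: le_trans (ler_norm_sum _ _ _) _; rewrite /b mulr_suml.
  exact: ler_sum.
have -> : uh = (uh - us - h * (\sum_j rest j - a m * us)) +
    ((1 - h * a m) * us + h * \sum_j rest j) by ring.
apply: le_trans (ler_normD _ _) _; rewrite addrC; apply: lerD; last first.
  by rewrite -sumE.
apply: le_trans (ler_normD _ _) _; rewrite normrM lerD2l normrM -mulrA.
by rewrite (ger0_norm h0) ler_wpM2l.
Qed.

End Decay.

Lemma norm_le_sup_norm {R : realType} {dA : Order.disp_t} {A : finTBOrderType dA}
    {L : countType} (K : {fset L}) (f : (L -> A) -> R) s :
  depends_on K f -> `|f s| <= sup_norm f.
Proof.
move=> /local_bounded[M fM]; apply: ub_le_sup; last by exists s.
by exists M => _ [u _ <-].
Qed.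

Section Covariance.
Context {R : realType} {dA : Order.disp_t} {A : finTBOrderType dA}
  {L : countType} {N : L -> {fset L}} (p : transition_family R A N)
  (x y : nonmin A -> R).
Hypothesis jN : forall j, j \in N j.
Hypothesis ptr : is_transition_matrix p.
Hypothesis cN : causal R N.
Hypothesis xy : forall a, x a != y a.
Hypothesis xy_le1 : forall a, `|x a| <= 1 /\ `|y a| <= 1.
Hypothesis xy_le0 : forall a, x a * y a <= 0.
Hypothesis xy_lt : forall a b : nonmin A, (val b < val a)%O ->
  `|x b| + `|y a| + `|x b * y a| <= 1.
Hypothesis diag_bounded : exists M : R, forall j a,
  `|update_coef x y p j a (pindex1 j a)| <= M.
Hypothesis alpha_lt1 : (alpha x y p < 1)%E.

Let lam := 1 - fine (alpha x y p).

Lemma rate_gt0 : 0 < lam.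
Proof.
rewrite /lam subr_gt0; case: (alpha x y p) alpha_lt1 => [r||] //=.
Qed.

(** The coefficients at [j] are supported in the neighbourhood of [j], so
    that this is the expression under the supremum in [alpha]. *)
Lemma row_sum_le j a : update_coef x y p j a (pindex1 j a) +
  \sum_(m <- finsupp (update_coef x y p j a) | m != pindex1 j a)
    `|update_coef x y p j a m| <= 1 - lam.
Proof.
have [sub _] := update_coefP p a xy (jN j).
set s := _ + _.
have : (s%:E <= alpha x y p)%E.
  apply: ereal_sup_ubound; exists (j, a) => //=; congr (_ + _)%:E.
  rewrite big_seq_cond [RHS]big_seq_cond; apply: eq_bigl => m.
  by case: (boolP (m \in _)) => //= /sub ->.
rewrite /lam opprB addrC subrK.
by case: (alpha x y p) alpha_lt1 => [r||] //=; rewrite lee_fin.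
Qed.

Lemma covariance_decay (f g : (L -> A) -> R) (d : measure_display)
    (T : measurableType d) (P : probability T R) (zeta : R -> T -> L -> A) t :
  is_local f -> is_local g -> in_IPS p P zeta -> 0 <= t ->
  (`|correlation P zeta f g t| <=
    (2 * sup_norm f * pi_norm x y g * expR (- lam * t))%:E)%E.
Proof.
move=> [K0 fK] gl zI t0; have [K gK] := gl.
have [M CM] := diag_bounded.
have zm : forall t j a, 0 <= t -> measurable [set w | zeta t w j = a] by case: zI.
have bf : bounded_mfun (fun w => f (zeta 0 w)) by exact: (bounded_mfun_state zm (lexx 0) fK).
have bg : bounded_mfun (fun w => g (zeta t w)) by exact: (bounded_mfun_state zm t0 gK).
pose e := mean P (fun w => f (zeta 0 w)).
pose f' s := f s - e.
have f'K : depends_on K0 f' by move=> s s' ss'; rewrite /f' (fK _ _ ss').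
have f'U s : `|f' s| <= 2 * sup_norm f.
  apply: le_trans (ler_normB _ _) _; rewrite mulr_natl mulr2n; apply: lerD.
    exact: norm_le_sup_norm fK.
  by apply: norm_mean_le => // w; exact: norm_le_sup_norm fK.
have f'0 : mean P (fun w => f' (zeta 0 w)) = 0.
  by rewrite /f' meanB //; [rewrite mean_cst subrr|exact: bounded_mfun_cst].
pose c := 1 + `|M| + lam.
have lamc : lam <= c by rewrite lerDr addr_ge0.
have diag j a : 1 - update_coef x y p j a (pindex1 j a) <= c.
  have := ler_norm M; have := rate_gt0; have := CM j a.
  by rewrite ler_norml => /andP[h _] r0 M0; move: h; rewrite /c -/lam; lra.
pose u m := pairing P zeta f' t (chi x y m).
have uU m : `|u m| <= 2 * sup_norm f * expR (- lam * t).
  exact: (pairing_chi_decay jN ptr cN xy xy_le1 xy_le0 xy_lt zI rate_gt0 lamc diag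
    row_sum_le f'K f'U f'0).
rewrite /correlation covariance_centered // -/e abse_EFin lee_fin.
have -> : mean P (fun w => (f (zeta 0 w) - e) * g (zeta t w)) =
    \sum_(m <- finsupp (chi_coef x y g) | m != [fmap]%fmap) chi_coef x y g m * u m.
  rewrite -/(pairing P zeta f' t g).
  have {1}-> : g = fun s => \sum_(m <- finsupp (chi_coef x y g))
      chi_coef x y g m * chi x y m s.
    by apply/funext => s; exact: chi_coefP.
  rewrite (pairing_expansion x y zI f'K) // [RHS]big_mkcond; apply: eq_bigr => m _.
  case: eqP => //= ->; rewrite (_ : pairing _ _ _ _ _ = 0) ?mulr0 //.
  rewrite -[RHS]f'0 /pairing; congr mean; apply/funext => w.
  by rewrite chi_nil mulr1.
apply: le_trans (ler_norm_sum _ _ _) _.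
rewrite -mulrA [_ * expR _]mulrC mulrA /pi_norm mulr_sumr.
apply: ler_sum => m _; rewrite normrM mulrC ler_wpM2r //.
Qed.

End Covariance.

Theorem theorem6p9 (R : realType) (dA : Order.disp_t) (A : finTBOrderType dA)
    (L : countType) (N : L -> {fset L}) (p : transition_family R A N)
    (x y : nonmin A -> R) :
  (forall j, j \in N j) ->
  is_transition_matrix p ->
  causal R N ->
  (forall a, x a != y a) ->
  (forall a, `|x a| <= 1 /\ `|y a| <= 1) ->
  (forall a, x a * y a <= 0) ->
  (forall a b : nonmin A, (val b < val a)%O -> `|x b| + `|y a| + `|x b * y a| <= 1) ->
  (exists M : R, forall j a, `|update_coef x y p j a (pindex1 j a)| <= M) ->
  (alpha x y p < 1)%E ->
  [/\ uniform_decay p,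
      exponential_decay p &
      forall f g : (L -> A) -> R, is_local f -> is_local g ->
      forall (d : measure_display) (T : measurableType d)
        (P : probability T R) (zeta : R -> T -> L -> A),
      in_IPS p P zeta ->
      forall t : R, 0 <= t ->
      (`|correlation P zeta f g t| <=
        (2 * sup_norm f * pi_norm x y g *
           expR (- (1 - fine (alpha x y p)) * t))%:E)%E].
Proof.
move=> jN ptr cN xy xy_le1 xy_le0 xy_lt diag al1.
set lam := 1 - fine (alpha x y p).
have lam0 : 0 < lam by exact: rate_gt0.
have bound (f g : (L -> A) -> R) : is_local f -> is_local g ->
  forall (d : measure_display) (T : measurableType d)
    (P : probability T R) (zeta : R -> T -> L -> A),
  in_IPS p P zeta -> forall t : R, 0 <= t ->
  (`|correlation P zeta f g t| <=
    (2 * sup_norm f * pi_norm x y g * expR (- lam * t))%:E)%E.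
  by move=> fl gl d T P zeta zI t t0; exact: covariance_decay.
split => //.
- move=> f g fl gl e e0.
  pose B := 2 * sup_norm f * pi_norm x y g.
  exists (Num.max 0 (ln (1 + `|B| / e) / lam)); split; first exact: num_real.
  move=> t; rewrite gt_max => /andP[t0 tln] d T P zeta zI.
  apply: le_trans (bound f g fl gl d T P zeta zI t (ltW t0)) _; rewrite lee_fin.
  have q0 : 0 < 1 + `|B| / e by rewrite ltr_pwDl // divr_ge0 // ltW.
  have qt : 1 + `|B| / e <= expR (lam * t).
    by rewrite -[leLHS]lnK ?posrE // ler_expR [lam * t]mulrC -ler_pdivrMr // ltW.
  apply: le_trans (ler_norm _) _; rewrite normrM (ger0_norm (expR_ge0 _)).
  rewrite mulNr expRN ler_pdivrMr ?expR_gt0 //.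
  apply: le_trans (ler_wpM2l (ltW e0) qt).
  by rewrite mulrDr mulr1 mulrCA divff ?gt_eqF // mulr1 lerDr ltW.
- exists lam => // f g fl gl; exists (2 * sup_norm f * pi_norm x y g).
  by move=> d T P zeta zI t t0; exact: bound.
Qed.
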